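(* Let $C\ge c/(1-\beta)$, where $c$ and $\beta$ are the constants in the distortion condition (JF) for the tower map $F$. For each integer $n\ge1$ there is a unique $\varphi_n\in\mathcal C_n$ such that $\mathcal P_n\varphi_n=\lambda_n\varphi_n$, where $\lambda_n=\|\mathcal P_n\varphi_n\|_{L^1(\Delta,\nu)}$. In addition, $\varphi_n$ is bounded above and below by positive constants (a.e. on $\Delta\setminus H_n$).
   Context: MAP. Let $\alpha\in(0,1)$ and let $T:[0,1]\to[0,1]$ be a Pomeau--Manneville map: near $0$, $T(x)=x+c_\alpha x^{1+\alpha}+g(x)$ with $c_\alpha>0$, $g$ of class $C^2$ and $g'(x)=o(x^\alpha)$ as $x\to0$; there is $x_0\in(0,1)$ such that $T$ is one-to-one and onto $(0,1)$ on each of $(0,x_0)$ and $(x_0,1)$; $T$ is $C^2$ on $(x_0,1)$ and on $(\epsilon,x_0)$ for every $\epsilon>0$; and $T'>1$ on $(0,x_0)$ and on $(x_0,1)$. TOWER. Put $\Delta_0=[x_0,1]$, $R(x)=\min\{k>0: T^k(x)\in(x_0,1)\}$ (first return time, defined a.e.), $\Delta_{0,i}=\{x\in\Delta_0: R(x)=i\}$ for $i\ge1$, $\Delta=\{(x,\ell): x\in\Delta_0,\ \ell\in\{0,1,2,\dots\},\ \ell<R(x)\}$, cells $\Delta_{\ell,i}=\Delta_{0,i}\times\{\ell\}$ ($0\le\ell<i$), levels $\Delta_\ell=\bigcup_{i>\ell}\Delta_{\ell,i}$; the base $\Delta_0$ is identified with $\Delta_0\times\{0\}$. The tower map $F:\Delta\to\Delta$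 is $F(x,\ell)=(x,\ell+1)$ if $\ell<R(x)-1$ and $F(x,R(x)-1)=(T^{R(x)}(x),0)$; each top cell $\Delta_{i-1,i}$ is mapped injectively onto $\Delta_0$ (mod null sets). The measure $\nu$ on $\Delta$ is Lebesgue measure on $\Delta_0$ lifted by upwards translation; it is finite. $JF=d(\nu\circ F)/d\nu$ is the Jacobian. The separation time $s(x,y)$ counts the number of returns to $\Delta_0$ before the orbits of $x$ and $y$ are in different elements of $\{\Delta_{0,i}\}$: for $x,y\in\Delta_0$, $s(x,y)$ is the least $k\ge0$ such that the $k$-th returns to $\Delta_0$ of $x$ and $y$ lie in different $\Delta_{0,i}$, and for $(x,\ell),(y,\ell)$ in the same cell, $s((x,\ell),(y,\ell))=s(x,y)$. It is assumed that $F$ is non-singular and satisfies, for constants $\beta\in(0,1)$ and $c<\infty$, (JF) $\left|\frac{JF(x)}{JF(y)}\right|\le e^{c\,\beta^{s(F(x),F(y))}}$ for $x,y$ in the same cell $\Delta_{\ell,i}$. HOLE AND OPERATORS. For an integer $n\ge1$ let $H_n=\bigcup_{i\ge n+1}\bigcup_{1\le\ell<i}\Delta_{\ell,i}$ be the hole and $H_n^1=\bigcup_{i\ge n+1}\Delta_{0,i}$. The Perron--Frobenius operator is $\mathcal P\varphi(x)=\sum_{y\in F^{-1}x}\varphi(y)/|JF(y)|$ on $L^1(\Delta,\nu)$, and the conditional operator is $\mathcal P_n\varphi=\chi_{\Delta\setminus H_n}\,\mathcal P(\varphi\,\chi_{\Delta\setminus H_n})$. CONES. Two points are comparable if both lie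 in the same cell $\Delta_{\ell,i}$ or both lie in $\Delta_0$. For a fixed $C>0$, $\mathcal C_*=\{\varphi\in L^1(\Delta,\nu): \varphi\ge0,\ \varphi(x)\le\varphi(y)e^{C\beta^{s(x,y)}}\text{ for a.e. comparable }x,y\}$ and $\mathcal C_n=\{\varphi\in\mathcal C_*: \int_{\Delta\setminus H_n}\varphi\,d\nu=1,\ \varphi|_{H_n}=0\}$. *)

(* Defs.v *)
From HB Require Import structures.
From mathcomp Require Import all_boot all_order all_algebra.
From mathcomp Require Import all_classical all_reals all_analysis.

Set Implicit Arguments.
Unset Strict Implicit.
Unset Printing Implicit Defensive.

Import Order.TTheory GRing.Theory Num.Theory.
Import numFieldNormedType.Exports.

Local Open Scope classical_set_scope.
Local Open Scope ring_scope.

(* [least P] is [Some k] for the least element [k] of [P], and [None] when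
   [P] is empty. *)
Definition least (P : set nat) : option nat :=
  xget None [set Some k | k in [set k | P k /\ forall j, P j -> (k <= j)%N]].

(* The library provides the sigma-finiteness of the counting measure on nat,
   but not its s-finiteness, which [sigma_finite_measure] requires. *)
Lemma sfinite_counting (R : realType) : sfinite_measure (@counting nat R).
Proof. exact/sfinite_measure_sigma_finite/sigma_finite_counting. Qed.

HB.instance Definition _ (R : realType) :=
  isSFinite.Build _ _ _ (@counting nat R) (@sfinite_counting R).

Section Map.
Variable R : realType.
Implicit Types (A : set R) (f T : R -> R) (alpha : R).

(* [A] is meant to be open. *)
Definition C2_on A f :=
  forall x, A x ->
    [/\ derivable f x 1, derivable (derive1 f) x 1 & {for x, continuous (derive1n 2 f)}].

(* A function is C^2 on [0, d[, with one-sided derivatives at 0, iff it is the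
   restriction of a C^2 function on ]-d, d[; whence the domain of [g]. *)
Definition neutral_at_0 alpha T :=
  exists (c_alpha : R) (g : R -> R) (d : R),
    [/\ 0 < c_alpha, 0 < d, C2_on `]- d, d[ g,
        derive1 g x / x `^ alpha @[x --> 0^'+] --> (0 : R)
      & forall x, 0 <= x < d -> T x = x + c_alpha * x `^ (1 + alpha) + g x].

Definition pomeau_manneville alpha x0 T :=
  [/\ 0 < alpha < 1, 0 < x0 < 1, (forall x, 0 <= x <= 1 -> 0 <= T x <= 1)
    & neutral_at_0 alpha T] /\
  [/\ set_bij `]0, x0[ `]0, 1[ T, set_bij `]x0, 1[ `]0, 1[ T,
      C2_on `]x0, 1[ T /\ (forall e, 0 < e -> C2_on `]e, x0[ T),
      (forall x, 0 < x < x0 -> 1 < derive1 T x)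
    & (forall x, x0 < x < 1 -> 1 < derive1 T x)].

End Map.

Notation tower_space R := (measurableTypeR R * nat)%type.

Section Tower.
Variables (R : realType) (x0 : R) (T : R -> R).

(* The tower is a subset [tower] of R * nat.  Functions on the tower are
   represented by functions on R * nat, whose values off [tower] are
   irrelevant. *)
Local Notation tower_space := (tower_space R).

Implicit Types (x y : R) (z w : tower_space) (i l n k : nat).

(* [None] on the (null) set of points which never return. *)
Definition return_time x : option nat :=
  least [set k | (0 < k)%N /\ x0 < iter k T x < 1].

Definition base_cell i : set R :=
  [set x | x0 <= x <= 1 /\ return_time x = Some i].

Definition cell l i : set tower_space :=
  [set z | (l < i)%N /\ base_cell i z.1 /\ z.2 = l].

Definition tower : set tower_space :=
  [set z | exists2 i, base_cell i z.1 & (z.2 < i)%N].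

Definition tower_base : set tower_space := [set z | tower z /\ z.2 = 0%N].

Definition tower_map z : tower_space :=
  if return_time z.1 is Some r then
    if (z.2 < r.-1)%N then (z.1, z.2.+1) else (iter r T z.1, 0%N)
  else z.

(* The measure of the tower is the restriction of [mu] to [tower]: integrals
   against it are written as integrals over [tower] against [mu]. *)
Definition mu : {measure set tower_space -> \bar R} :=
  (@lebesgue_measure R \x @counting nat R)%E.
Definition nu (A : set tower_space) : \bar R := mu (A `&` tower).

Definition ae_tower (P : set tower_space) := {ae mu, forall z, tower z -> P z}.

Definition first_return x : R :=
  if return_time x is Some r then iter r T x else x.

(* Points of which one does not belong to any [base_cell] (a null set) are
   separated. *)
Definition sep_time_base x y : option nat :=
  least [set k | ~ exists i, base_cell i (iter k first_return x) /\
                             base_cell i (iter k first_return y)].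

Definition sep_time z w := sep_time_base z.1 w.1.

(* beta ^ s, with beta ^ oo = 0 *)
Definition beta_pow (beta : R) (s : option nat) : R :=
  if s is Some k then beta ^+ k else 0.

Definition same_cell z w := exists l i, cell l i z /\ cell l i w.

Definition comparable z w :=
  same_cell z w \/ (tower_base z /\ tower_base w).

Definition nonsingular :=
  forall A : set tower_space, measurable A -> A `<=` tower ->
    nu A = 0%E -> nu (tower_map @^-1` A) = 0%E.

(* JF is (a version of) d(nu o F)/d nu; nu o F is additive on the measurable
   subsets of a cell, on which F is injective mod null sets. *)
Definition is_jacobian (JF : tower_space -> R) :=
  measurable_fun tower JF /\
  forall l i (A : set tower_space), measurable A -> A `<=` cell l i ->
    nu (tower_map @` A) = (\int[mu]_(z in A) (JF z)%:E)%E.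

Definition distortion (JF : tower_space -> R) (beta c : R) :=
  forall z w, same_cell z w ->
    `|JF z / JF w| <=
      expR (c * beta_pow beta (sep_time (tower_map z) (tower_map w))).

(* The sum of an absolutely summable family. *)
Definition sum_over (S : set tower_space) (f : tower_space -> R) : R :=
  fine (\esum_(z in S) ((EFin \o f)^\+ z) - \esum_(z in S) ((EFin \o f)^\- z))%E.

Definition perron_frobenius (JF : tower_space -> R) (phi : tower_space -> R)
    : tower_space -> R :=
  fun z => sum_over [set w | tower w /\ tower_map w = z]
                    (fun w => phi w / `|JF w|).

Definition hole n : set tower_space :=
  [set z | exists i l, [/\ (n.+1 <= i)%N, (1 <= l < i)%N & cell l i z]].

Definition conditional_op (JF : tower_space -> R) n (phi : tower_space -> R)
    : tower_space -> R :=
  fun z => \1_(tower `\` hole n) z *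
    perron_frobenius JF (fun w => phi w * \1_(tower `\` hole n) w) z.

Definition L1norm (phi : tower_space -> R) : \bar R :=
  (\int[mu]_(z in tower) `|phi z|%:E)%E.

Definition in_L1 (phi : tower_space -> R) := mu.-integrable tower (EFin \o phi).

Definition cone (beta C : R) : set (tower_space -> R) :=
  [set phi | [/\ in_L1 phi,
    ae_tower [set z | 0 <= phi z]
  & exists N : set tower_space, mu.-negligible N /\
      forall z w, ~ N z -> ~ N w -> comparable z w ->
        phi z <= phi w * expR (C * beta_pow beta (sep_time z w))]].

Definition cone_n (beta C : R) n : set (tower_space -> R) :=
  [set phi | [/\ cone beta C phi,
    (\int[mu]_(z in tower `\` hole n) (phi z)%:E)%E = 1%E
  & ae_tower [set z | hole n z -> phi z = 0]]].

Definition cond_eigenfunction (JF : tower_space -> R) n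
    (phi : tower_space -> R) :=
  ae_tower [set z | (conditional_op JF n phi z)%:E =
                    (L1norm (conditional_op JF n phi) * (phi z)%:E)%E].

End Tower.

(* Main.v *)
Require Import Defs.
From mathcomp Require Import all_boot all_order all_algebra.
From mathcomp Require Import all_classical all_reals all_analysis.
From mathcomp Require Import measurable_realfun.
From mathcomp Require Import ring lra.

Set Implicit Arguments.
Unset Strict Implicit.
Unset Printing Implicit Defensive.

Import Order.TTheory GRing.Theory Num.Theory.
Import numFieldNormedType.Exports.
Local Open Scope classical_set_scope.
Local Open Scope ring_scope.

(** Why the theorem holds.  Away from the hole, an eigenfunction is determined
by its restriction [f] to the base.  Below the top of a column the Jacobian is
1 almost everywhere, because [tower_map] only translates there; so the
conditional operator moves the values of a function one level up, and an
eigenfunction with eigenvalue [expR (- s)] equals [expR (s * l) * f x] at the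
point [(x, l)].  The eigenvalue equation on the base then says that [f] is
fixed by the transfer operator

    [L_s f x = \sum_(i < n) expR (s * i.+1) * f (h i x) / `|JF (h i x, i)|],

where [h i] is the inverse of the branch of the first return map with return
time [i.+1]: the columns of height at most [n] are those that return to the
base through the complement of the hole.  The theorem therefore amounts to
this: for exactly one [s] the operator [L_s] fixes a function of the cone, and
it fixes only one, up to a factor.

For a given [s] this is a Perron-Frobenius theorem ([transfer_eigenfunction],
[fixed_function_unique]).  The branches contract the scale [beta ^ s(x, y)] by
the factor [beta], and the distortion of the weights is at most
[(1 - beta) * C]; so [L_s] maps the cone of constant [D] into the cone of
constant [beta * D + (1 - beta) * C].  It preserves the cone of constant [C]
and maps that of constant [2 * C] strictly inside itself.  In the order given
by the latter, two elements [f] and [g] are squeezed,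
[lo * g <= f <= up * g], and each application of [L_s] shortens the interval
from [lo] to [up] by a fixed factor ([ratio_contraction]).  This is Birkhoff's
contraction of cones, carried out with an explicit pair of bounds instead of
the projective metric.

The choice of [s] is Bowen's equation: the leading eigenvalue [rho s] of [L_s]
satisfies [t - s <= ln (rho t) - ln (rho s) <= n * (t - s)] for [s <= t], so
that [ln (rho s)] is continuous, strictly increasing and has exactly one zero
([critical_tilt], [critical_tilt_unique]).

All this is pointwise, while the cone, the Jacobian and the eigenvalue equation
are only known almost everywhere.  The two are reconciled on a Borel set of
base points that has full measure, avoids the exceptional null sets and is
mapped into itself by every [h i] ([negligible_saturation],
[regular_exists]).  Such a set exists because the preimage of a null set under
[h i] is null: its measure is the integral of the Jacobian over a null set
([branch_preimage_measure]). *)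

(** * Fixed functions of a weighted transfer operator *)

Lemma cvg_of_geometric_steps (R : realType) (u : R^nat) (W q : R) :
  0 <= q < 1 -> (forall k, `|u k.+1 - u k| <= W * q ^+ k) -> cvgn u.
Proof.
move=> /andP[q0 q1] hu.
have cs : cvgn (series (telescope u)).
  apply: normed_cvg; apply: (@series_le_cvg _ _ (geometric W q)) => [k|k|k|].
  - exact: normr_ge0.
  - exact: le_trans (normr_ge0 _) (hu k).
  - exact: hu.
  - by apply: is_cvg_geometric_series; rewrite ger0_norm.
rewrite (_ : u = (fun k => u 0%N + series (telescope u) k)).
  by apply: is_cvgD => //; exact: is_cvg_cst.
by apply/funext => k; exact: eq_sum_telescope.
Qed.

Lemma le_geometric_le0 (R : realType) (d A q : R) : 0 <= q < 1 ->
  (forall k, d <= A * q ^+ k) -> d <= 0.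
Proof.
move=> /andP[q0 q1] dA.
apply: (@ler_cvg_to nat \oo _ R (fun=> d) (geometric A q)).
- exact: cvg_cst.
- by apply: cvg_geometric; rewrite ger0_norm.
- by apply: nearW => k; exact: dA.
Qed.

Section transfer_operator.
Context {R : realType} {U : Type}.
Variables (X : set U) (n : nat) (h : nat -> U -> U) (b : U -> U -> R).
Variables (beta C : R).
Implicit Types (w : nat -> U -> R) (f g u v : U -> R).

Definition transfer w f : U -> R :=
  fun x => \sum_(i < n) w i x * f (h i x).

Definition logcone (D : R) f :=
  (forall x, X x -> 0 <= f x) /\
  forall x y, X x -> X y -> f x <= f y * expR (D * b x y).

(** The distortion constant [(1 - beta) * C] is the one for which the cone of
constant [C] is invariant, see [transfer_logcone_C]. *)
Definition distorted_weight w :=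
  (forall i x, X x -> 0 < w i x) /\
  forall i x y, X x -> X y -> w i x <= w i y * expR ((1 - beta) * C * b x y).

(** The number [b x y] stands for [beta] to the power of the time during which
the orbits of [x] and [y] stay together.  It is only a scale, not a distance:
it may vanish on distinct points. *)
Definition contracting_branches :=
  [/\ forall i x, X x -> X (h i x),
      forall x y, 0 <= b x y <= 1,
      forall x y, b x y = b y x &
      forall i x y, X x -> X y -> b (h i x) (h i y) = beta * b x y].

Hypothesis hb : contracting_branches.
Hypothesis n0 : (0 < n)%N.
Hypothesis beta01 : 0 < beta < 1.
Hypothesis C0 : 0 < C.
Variable p : U.
Hypothesis Xp : X p.

Lemma logcone_le D D' f : D <= D' -> logcone D f -> logcone D' f.
Proof.
move=> DD' [f0 fD]; split=> // x y Xx Xy; apply: le_trans (fD x y Xx Xy) _.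
rewrite ler_wpM2l ?f0// ler_expR ler_wpM2r//.
by case: hb => _ /(_ x y)/andP[].
Qed.

Lemma logconeZ D f a : 0 <= a -> logcone D f -> logcone D (fun x => a * f x).
Proof.
move=> a0 [f0 fD]; split=> [x Xx|x y Xx Xy]; first by rewrite mulr_ge0// f0.
by rewrite -mulrA ler_wpM2l// fD.
Qed.

Lemma logcone_eq D f g : (forall x, X x -> f x = g x) ->
  logcone D f -> logcone D g.
Proof.
move=> fg [f0 fD]; split=> [x Xx|x y Xx Xy]; first by rewrite -fg// f0.
by rewrite -!fg// fD.
Qed.

Lemma logcone_harnack D f x y : 0 <= D -> logcone D f -> X x -> X y ->
  f x <= f y * expR D.
Proof.
move=> D0 [f0 fD] Xx Xy; apply: le_trans (fD x y Xx Xy) _.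
rewrite ler_wpM2l ?f0// ler_expR ler_piMr//.
by case: hb => _ /(_ x y)/andP[].
Qed.

Lemma logcone_gt0 D f x y : 0 <= D -> logcone D f -> X x -> X y ->
  0 < f x -> 0 < f y.
Proof.
move=> D0 fD Xx Xy fx0.
have := logcone_harnack D0 fD Xx Xy.
by move=> /(lt_le_trans fx0); rewrite pmulr_lgt0// expR_gt0.
Qed.

Lemma logcone_cst D : 0 <= D -> logcone D (fun=> 1).
Proof.
move=> D0; split=> // x y _ _; rewrite mul1r -[leLHS]expR0 ler_expR mulr_ge0//.
by case: hb => _ /(_ x y)/andP[].
Qed.

Lemma transfer_logcone w D f : distorted_weight w -> logcone D f ->
  logcone (beta * D + (1 - beta) * C) (transfer w f).
Proof.
case: hb => hX _ _ bh [w0 wd] [f0 fD]; split=> [x Xx|x y Xx Xy].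
  by rewrite sumr_ge0// => i _; rewrite mulr_ge0 ?f0 ?(ltW (w0 _ _ _))//; exact: hX.
rewrite mulr_suml ler_sum// => i _.
have -> : (beta * D + (1 - beta) * C) * b x y =
   (1 - beta) * C * b x y + D * b (h i x) (h i y) by rewrite bh//; ring.
rewrite expRD mulrACA ler_pM ?wd ?f0 ?fD ?(ltW (w0 _ _ _))//; exact: hX.
Qed.

Lemma transfer_logcone_C w f : distorted_weight w -> logcone C f ->
  logcone C (transfer w f).
Proof.
move=> gw /(transfer_logcone gw); congr (logcone _ _); ring.
Qed.

Lemma iter_transfer_logcone w f k : distorted_weight w -> logcone C f ->
  logcone C (iter k (transfer w) f).
Proof. by move=> gw fC; elim: k => //= k; exact: transfer_logcone_C. Qed.

Lemma transfer_gt0 w f x : distorted_weight w -> (forall y, X y -> 0 < f y) ->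
  X x -> 0 < transfer w f x.
Proof.
case: hb => hX _ _ _ [w0 _] f0 Xx; rewrite /transfer.
case: n n0 => // m _; rewrite big_ord_recl ltr_wpDr//.
  by rewrite sumr_ge0// => i _; rewrite mulr_ge0// ltW// ?w0 ?f0//; exact: hX.
by rewrite mulr_gt0 ?w0 ?f0//; exact: hX.
Qed.

Lemma iter_transfer_gt0 w f x k : distorted_weight w -> (forall y, X y -> 0 < f y) ->
  X x -> 0 < iter k (transfer w) f x.
Proof.
move=> gw f0; elim: k x => [|k IH] x Xx /=; first exact: f0.
exact: transfer_gt0.
Qed.

Lemma eq_transfer w f g x : (forall y, X y -> f y = g y) -> X x ->
  transfer w f x = transfer w g x.
Proof.
by case: hb => hX _ _ _ fg Xx; apply: eq_bigr => i _; rewrite fg//; exact: hX.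
Qed.

Lemma le_transfer w f g x : distorted_weight w -> (forall y, X y -> f y <= g y) ->
  X x -> transfer w f x <= transfer w g x.
Proof.
case: hb => hX _ _ _ [w0 _] fg Xx.
by apply: ler_sum => i _; rewrite ler_wpM2l ?fg ?(ltW (w0 _ _ _))//; exact: hX.
Qed.

Lemma transferZ w a f x : transfer w (fun y => a * f y) x = a * transfer w f x.
Proof. by rewrite /transfer mulr_sumr; apply: eq_bigr => i _; ring. Qed.

Lemma transferBZ w f g a x :
  transfer w (fun y => f y - a * g y) x = transfer w f x - a * transfer w g x.
Proof.
rewrite /transfer mulr_sumr -sumrB; apply: eq_bigr => i _; ring.
Qed.

Lemma transferZB w f g a x :
  transfer w (fun y => a * g y - f y) x = a * transfer w g x - transfer w f x.
Proof.
rewrite /transfer mulr_sumr -sumrB; apply: eq_bigr => i _; ring.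
Qed.

Let D1 := (1 + beta) * C.
Let D2 := 2 * C.
Let eps := (1 - beta) / (4 * expR D2).
Let delta := eps * expR (- (2 * D1)).

Let beta0 : 0 < beta. Proof. by case/andP: beta01. Qed.
Let beta1 : beta < 1. Proof. by case/andP: beta01. Qed.
Let D10 : 0 <= D1.
Proof. by rewrite /D1 mulr_ge0 ?addr_ge0// ltW. Qed.
Let D20 : 0 <= D2. Proof. by rewrite /D2 mulr_ge0// ltW. Qed.
Let CD1 : C <= D1. Proof. by rewrite /D1 mulrDl mul1r lerDl mulr_ge0// ltW. Qed.

Let eps01 : 0 < eps < 1.
Proof.
have [b0 b1] := (beta0, beta1).
have e1 : 1 <= expR D2 by rewrite -[leLHS]expR0 ler_expR.
rewrite /eps; apply/andP; split; first by apply: divr_gt0; lra.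
by rewrite ltr_pdivrMr; lra.
Qed.

Let delta01 : 0 < delta < 1.
Proof.
have e1 : expR (- (2 * D1)) <= 1 by rewrite -[leRHS]expR0 ler_expR oppr_le0 mulr_ge0.
have e0 := expR_gt0 (- (2 * D1)).
have [p0 p1] := andP eps01.
rewrite /delta; apply/andP; split; nra.
Qed.

(** Elements of the cone of constant [D1] lie well inside the cone of constant
[D2], uniformly and as measured at the single point [p]; this is where the
contraction comes from.  With [B := b x y], the claim for [x] and [y] reads
[k * (v y * expR (D2 * B) - v x) <= u y * expR (D2 * B) - u x].  Both sides are
of order [B]: the left one is at most [k * v y] times a multiple of [B], the
right one at least [u y] times a multiple of [B], as [D1 < D2]. *)
Lemma logcone_sub u v k : logcone D1 u -> logcone D1 v ->
  0 <= k -> k * v p <= delta * u p -> logcone D2 (fun x => u x - k * v x).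
Proof.
move=> uD vD k0 kp.
have kuv y : X y -> k * v y <= eps * u y.
  move=> Xy.
  have vyp := logcone_harnack D10 vD Xy Xp.
  have upy := logcone_harnack D10 uD Xp Xy.
  apply: (@le_trans _ _ (k * (v p * expR D1))); first by rewrite ler_wpM2l.
  rewrite mulrA; apply: (@le_trans _ _ (delta * u p * expR D1)).
    by rewrite ler_wpM2r// expR_ge0.
  apply: (@le_trans _ _ (delta * (u y * expR D1) * expR D1)).
    rewrite ler_wpM2r ?expR_ge0// ler_wpM2l//.
    by case/andP: delta01 => /ltW.
  have -> : delta * (u y * expR D1) * expR D1 =
    eps * u y * (expR (- (2 * D1)) * expR D1 * expR D1) by rewrite /delta; ring.
  by rewrite -!expRD (_ : _ + _ = 0) ?expR0 ?mulr1//; ring.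
split=> [x Xx|x y Xx Xy].
  have /= := kuv x Xx; have := uD.1 x Xx; move: eps01 => /andP[]; nra.
have /andP[b0 b1] : 0 <= b x y <= 1 by case: hb.
have bs : b x y = b y x by case: hb.
have [be0 be1] := (beta0, beta1).
have ux := uD.2 x y Xx Xy.
have vx := vD.2 y x Xy Xx; rewrite -bs in vx.
have {}kuv := kuv y Xy.
have uy0 := uD.1 y Xy; have vy0 := vD.1 y Xy; have vx0 := vD.1 x Xx.
set B := b x y in b0 b1 ux vx *.
set E := expR (D2 * B).
set E1 := expR (D1 * B) in ux vx *.
have E0 : 0 < E := expR_gt0 _.
have E10 : 0 < E1 := expR_gt0 _.
have E11 : 1 <= E1 by rewrite -[leLHS]expR0 ler_expR mulr_ge0.
have cB : 0 <= (1 - beta) * C * B.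
  by rewrite mulr_ge0// mulr_ge0 ?subr_ge0// ltW.
(* Lower bound for the room that [u] leaves in the wide cone. *)
have Elow : (1 - beta) * C * B <= E - E1.
  have -> : E = E1 * expR ((1 - beta) * C * B).
    by rewrite -expRD; congr expR; rewrite /D1 /D2; ring.
  have := expR_ge1Dx ((1 - beta) * C * B).
  by nra.
(* Upper bound for the room that [v] takes. *)
have Eup : E - E1^-1 <= 4 * C * B * expR D2.
  have EE : E <= expR D2 by rewrite ler_expR ler_piMr.
  have iE : E * expR (- (4 * C * B)) <= E1^-1.
    rewrite -expRN -expRD ler_expR /D1 /D2.
    lra.
  have := expR_ge1Dx (- (4 * C * B)).
  have : 0 <= C * B by rewrite mulr_ge0// ltW.
  by nra.
have vx' : v y / E1 <= v x by rewrite ler_pdivrMr.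
have step : k * v y * (E - E1^-1) <= u y * (E - E1).
  apply: (@le_trans _ _ (k * v y * (4 * C * B * expR D2))).
    by rewrite ler_wpM2l// mulr_ge0.
  apply: (@le_trans _ _ (eps * u y * (4 * C * B * expR D2))).
    rewrite ler_wpM2r// !mulr_ge0 ?expR_ge0//; exact: ltW.
  have -> : eps * u y * (4 * C * B * expR D2) = u y * ((1 - beta) * C * B).
    by rewrite /eps; field; rewrite ?gt_eqF ?expR_gt0.
  by rewrite ler_wpM2l.
have kvx : k * (v y / E1) <= k * v x by rewrite ler_wpM2l.
rewrite mulrBr mulrBr in step; rewrite mulrBl; lra.
Qed.

Section contraction.
Variables (w : nat -> U -> R) (f g : U -> R).
Hypotheses (gw : distorted_weight w) (fC : logcone C f) (gC : logcone C g).
Hypotheses (fp : 0 < f p) (gp : 0 < g p).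

Let f0 x : X x -> 0 < f x.
Proof. by move=> Xx; apply: (logcone_gt0 _ fC Xp Xx fp); exact: ltW. Qed.
Let g0 x : X x -> 0 < g x.
Proof. by move=> Xx; apply: (logcone_gt0 _ gC Xp Xx gp); exact: ltW. Qed.

Let L k u := iter k (transfer w) u.
Let r k := L k f p / L k g p.
Let lo := fix lo k := if k is k'.+1 then lo k' + delta * (r k - lo k')
                      else delta * (f p / g p).
Let up := fix up k := if k is k'.+1 then up k' - delta * (up k' - r k)
                      else f p / (delta * g p).

Let logcone_step u : logcone D2 u -> logcone D1 (transfer w u).
Proof.
move=> /(transfer_logcone gw); congr (logcone _ _); rewrite /D1 /D2; ring.
Qed.

Let sandwich k :
  logcone D2 (fun x => L k f x - lo k * L k g x) /\
  logcone D2 (fun x => up k * L k g x - L k f x).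
Proof.
have [dl0 dl1] := andP delta01.
have fD1 := logcone_le CD1 fC; have gD1 := logcone_le CD1 gC.
elim: k => [|k [IHlo IHup]].
  split.
    apply: logcone_sub => //=; first by rewrite mulr_ge0 ?divr_ge0// ltW.
    by rewrite -mulrA divfK ?gt_eqF.
  (* The upper bound is the lower one with [f] and [g] exchanged. *)
  have gf : logcone D2 (fun x => g x - delta * (g p / f p) * f x).
    apply: logcone_sub => //=; first by rewrite mulr_ge0 ?divr_ge0// ltW.
    by rewrite -mulrA divfK ?gt_eqF.
  have a0 : 0 <= f p / (delta * g p) by apply: divr_ge0; [|apply: mulr_ge0]; exact: ltW.
  apply: logcone_eq (logconeZ a0 gf) => x Xx /=.
  by field; rewrite !gt_eqF.
have Lgp m : 0 < L m g p by exact: iter_transfer_gt0.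
have gk : logcone D1 (L k.+1 g).
  exact: logcone_le CD1 (iter_transfer_logcone _ gw gC).
have lo1 := logcone_step IHlo; have up1 := logcone_step IHup.
have tlo x : transfer w (fun y => L k f y - lo k * L k g y) x =
  L k.+1 f x - lo k * L k.+1 g x by rewrite transferBZ.
have tup x : transfer w (fun y => up k * L k g y - L k f y) x =
  up k * L k.+1 g x - L k.+1 f x by rewrite transferZB.
have rE : r k.+1 * L k.+1 g p = L k.+1 f p by rewrite /r divfK// gt_eqF.
split.
- have k0 : 0 <= delta * (r k.+1 - lo k).
    rewrite mulr_ge0 ?(ltW dl0)// subr_ge0 /r ler_pdivlMr//.
    by have := lo1.1 p Xp; rewrite tlo subr_ge0.
  have kp : delta * (r k.+1 - lo k) * L k.+1 g p <=
      delta * transfer w (fun y => L k f y - lo k * L k g y) p.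
    by rewrite tlo -rE -mulrBl mulrA.
  apply: logcone_eq (logcone_sub lo1 gk k0 kp) => x Xx.
  rewrite tlo /=; ring.
- have k0 : 0 <= delta * (up k - r k.+1).
    rewrite mulr_ge0 ?(ltW dl0)// subr_ge0 /r ler_pdivrMr//.
    by have := up1.1 p Xp; rewrite tup subr_ge0.
  have kp : delta * (up k - r k.+1) * L k.+1 g p <=
      delta * transfer w (fun y => up k * L k g y - L k f y) p.
    by rewrite tup -rE -mulrBl mulrA.
  apply: logcone_eq (logcone_sub up1 gk k0 kp) => x Xx.
  rewrite tup /=; ring.
Qed.

(** By [logcone_sub], applying the operator makes room for moving both bounds
towards the ratio of the two functions at [p], by the fraction [delta] of their
distance to that ratio. *)
Lemma ratio_contraction : exists lo up : nat -> R,
  [/\ 0 < lo 0%N,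
      forall k, lo k <= lo k.+1, forall k, up k.+1 <= up k,
      forall k, up k - lo k = (up 0%N - lo 0%N) * (1 - delta) ^+ k &
      forall k x, X x -> lo k * iter k (transfer w) g x <=
        iter k (transfer w) f x <= up k * iter k (transfer w) g x].
Proof.
have [dl0 dl1] := andP delta01.
have Lgp m : 0 < L m g p by exact: iter_transfer_gt0.
have swp k : lo k <= r k.+1 <= up k.
  have [l1 l2] := sandwich k.
  have := (logcone_step l1).1 p Xp; have := (logcone_step l2).1 p Xp.
  rewrite transferBZ transferZB !subr_ge0 => hu hl.
  by rewrite /r ler_pdivlMr// ler_pdivrMr//; apply/andP; split.
exists lo, up; split.
- by rewrite /= mulr_gt0// divr_gt0.
- by move=> k /=; rewrite lerDl mulr_ge0 ?(ltW dl0)// subr_ge0; case/andP: (swp k).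
- by move=> k /=; rewrite gerBl mulr_ge0 ?(ltW dl0)// subr_ge0; case/andP: (swp k).
- elim=> [|k IH]; first by rewrite expr0 mulr1.
  rewrite exprS mulrCA -IH /=; ring.
- move=> k x Xx; have [l1 l2] := sandwich k.
  by have := l1.1 x Xx; have := l2.1 x Xx; rewrite !subr_ge0 => -> ->.
Qed.

End contraction.


Lemma iter_transfer_fix w f k x : (forall y, X y -> transfer w f y = f y) ->
  X x -> iter k (transfer w) f x = f x.
Proof.
move=> ff; elim: k x => //= k IH x Xx.
by rewrite -[RHS]ff//; apply: eq_transfer.
Qed.

Let delta_ratio : 0 <= 1 - delta < 1.
Proof. by have [d0 d1] := andP delta01; apply/andP; split; lra. Qed.

(** The operator does not change the two functions, while it closes the gap
between the bounds on their ratio. *)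
Lemma fixed_function_unique w f g : distorted_weight w ->
  logcone C f -> logcone C g -> 0 < f p -> 0 < g p ->
  (forall x, X x -> transfer w f x = f x) ->
  (forall x, X x -> transfer w g x = g x) ->
  forall x, X x -> f x * g p = g x * f p.
Proof.
move=> gw fC gC fp gp ff gf x Xx.
have [lo [up [_ _ _ width sand]]] := ratio_contraction gw fC gC fp gp.
have {}sand k y : X y -> lo k * g y <= f y <= up k * g y.
  by move=> Xy; have := sand k y Xy; rewrite !iter_transfer_fix.
have gx := gC.1 x Xx.
suff : `|f x * g p - g x * f p| <= 0 by rewrite normr_le0 subr_eq0 => /eqP.
apply: (le_geometric_le0 (A := (up 0%N - lo 0%N) * (g x * g p)) delta_ratio) => k.
rewrite mulrAC -width.
have /andP[lx ux] := sand k x Xx; have /andP[lp up'] := sand k p Xp.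
have h1 : 0 <= (f x - lo k * g x) * g p by rewrite mulr_ge0 ?subr_ge0// ltW.
have h2 : 0 <= (up k * g x - f x) * g p by rewrite mulr_ge0 ?subr_ge0// ltW.
have h3 : 0 <= g x * (f p - lo k * g p) by rewrite mulr_ge0 ?subr_ge0.
have h4 : 0 <= g x * (up k * g p - f p) by rewrite mulr_ge0 ?subr_ge0.
by rewrite ler_norml; apply/andP; split; lra.
Qed.

(** A multiple [r * f] lies below [g].  Applying the operator [k] times gives
[r * rho ^+ k * f <= sigma ^+ k * g], which is absurd for large [k] if
[sigma < rho]. *)
Lemma eigenvalue_le w f g (rho sigma : R) : distorted_weight w ->
  logcone C f -> logcone C g -> 0 < f p -> 0 < g p -> 0 < rho -> 0 < sigma ->
  (forall x, X x -> rho * f x <= transfer w f x) ->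
  (forall x, X x -> transfer w g x <= sigma * g x) -> rho <= sigma.
Proof.
move=> gw fC gC fp gp rho0 sigma0 ff gf; rewrite leNgt; apply/negP => sr.
have C0' := ltW C0.
pose r := g p / (f p * expR C * expR C).
have r0 : 0 < r by rewrite divr_gt0// !mulr_gt0// expR_gt0.
have init x : X x -> r * f x <= g x.
  move=> Xx; have h1 := logcone_harnack C0' fC Xx Xp.
  have h2 := logcone_harnack C0' gC Xp Xx.
  apply: (@le_trans _ _ (r * (f p * expR C))); first by rewrite ler_wpM2l// ltW.
  have -> : r * (f p * expR C) = g p / expR C.
    by rewrite /r; field; rewrite !gt_eqF ?expR_gt0.
  by rewrite ler_pdivrMr ?expR_gt0.
have iterated k x : X x -> r * rho ^+ k * f x <= sigma ^+ k * g x.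
  elim: k x => [|k IH] x Xx; first by rewrite !expr0 mulr1 mul1r init.
  apply: (@le_trans _ _ (r * rho ^+ k * transfer w f x)).
    rewrite exprSr mulrA -[leLHS]mulrA ler_wpM2l ?ff//.
    by rewrite mulr_ge0 ?exprn_ge0// ltW.
  apply: (@le_trans _ _ (sigma ^+ k * transfer w g x)).
    by rewrite -!transferZ; apply: le_transfer.
  by rewrite exprSr -mulrA ler_wpM2l ?gf// exprn_ge0// ltW.
have : r * f p <= 0.
  apply: (@le_geometric_le0 _ _ (g p) (sigma / rho)).
    by rewrite divr_ge0 ?ltW//= ltr_pdivrMr// mul1r.
  move=> k; rewrite expr_div_n mulrA ler_pdivlMr ?exprn_gt0//.
  by rewrite mulrAC [leRHS]mulrC iterated.
by rewrite leNgt mulr_gt0.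
Qed.

(** Compare the iterates of the constant 1 with their own images: the ratio of
two successive iterates becomes constant at a geometric rate, so that the
iterates, normalized at [p], converge.  The eigenfunction is presented as the
limit of multiples of these iterates because that makes it measurable. *)
Lemma transfer_eigenfunction w : distorted_weight w ->
  exists (rho : R) (a : R^nat) (f : U -> R),
  [/\ 0 < rho, logcone C f, f p = 1,
      forall x, X x -> transfer w f x = rho * f x &
      forall x, X x -> (fun k => a k * iter k (transfer w) (fun=> 1) x) @ \oo --> f x].
Proof.
move=> gw; have C0' := ltW C0; have oneC := logcone_cst C0'.
pose M k := iter k (transfer w) (fun=> 1 : R).
have M0 k x : X x -> 0 < M k x by move=> Xx; exact: iter_transfer_gt0.
have MC k : logcone C (M k) by exact: iter_transfer_logcone.
have [lo [up [lo0 loS upS width sand]]] :=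
  ratio_contraction gw (MC 1%N) oneC (M0 1%N p Xp) ltr01.
pose rho k x := M k.+1 x / M k x.
have rhoE k x : X x -> lo k <= rho k x <= up k.
  move=> Xx; have := sand k x Xx; rewrite /rho ler_pdivlMr ?M0// ler_pdivrMr ?M0//.
  by rewrite -[iter k _ (M 1%N)]iterSr.
have loge k : lo 0%N <= lo k by elim: k => // k /le_trans; apply.
have rho_dist k x y : X x -> X y ->
    `|rho k x - rho k y| <= (up 0%N - lo 0%N) * (1 - delta) ^+ k.
  move=> Xx Xy; rewrite -width ler_norml.
  have /andP[? ?] := rhoE k x Xx; have /andP[? ?] := rhoE k y Xy.
  by apply/andP; split; lra.
pose F k x := M k x / M k p.
have FS k x : X x -> F k.+1 x - F k x = F k x * (rho k x - rho k p) / rho k p.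
  by move=> Xx; rewrite /F /rho; field; rewrite !gt_eqF ?M0.
have FC k x : X x -> 0 <= F k x <= expR C.
  move=> Xx; rewrite divr_ge0 ?(ltW (M0 _ _ _))//= ler_pdivrMr ?M0// mulrC.
  exact: logcone_harnack.
have Fcvg x : X x -> cvgn (F ^~ x).
  move=> Xx; apply: (@cvg_of_geometric_steps _ _
    (expR C * (up 0%N - lo 0%N) / lo 0%N) (1 - delta)) => // k.
  rewrite FS// normrM normfV normrM.
  have /andP[F0 F1] := FC k x Xx.
  have /andP[r0 _] := rhoE k p Xp.
  have lr : lo 0%N <= rho k p := le_trans (loge k) r0.
  have rp : 0 < rho k p := lt_le_trans lo0 lr.
  rewrite (ger0_norm F0) (gtr0_norm rp) ler_pdivrMr//.
  apply: (@le_trans _ _ (expR C * ((up 0%N - lo 0%N) * (1 - delta) ^+ k))).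
    by rewrite ler_pM ?rho_dist.
  set A := (_ - _) * _ ^+ k.
  have A0 : 0 <= A by apply: le_trans (rho_dist k p p Xp Xp).
  have -> : expR C * (up 0%N - lo 0%N) / lo 0%N * (1 - delta) ^+ k * rho k p =
    expR C * A * (rho k p / lo 0%N) by rewrite /A; ring.
  apply: ler_peMr; first by rewrite mulr_ge0// expR_ge0.
  by rewrite ler_pdivlMr// mul1r.
have rhocvg : cvgn (rho ^~ p).
  apply: (@cvg_of_geometric_steps _ _ (up 0%N - lo 0%N) (1 - delta)) => // k.
  rewrite -width ler_norml.
  have /andP[? ?] := rhoE k p Xp; have /andP[? ?] := rhoE k.+1 p Xp.
  have ? := loS k; have ? := upS k.
  by apply/andP; split; lra.
pose f x := limn (F ^~ x).
have Ff x : X x -> F ^~ x @ \oo --> f x by exact: Fcvg.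
exists (limn (rho ^~ p)), (fun k => (M k p)^-1), f; split.
- apply: lt_le_trans lo0 _; apply: limr_ge => //; apply: nearW => k.
  by apply: le_trans (loge k) _; case/andP: (rhoE k p Xp).
- split=> [x Xx|x y Xx Xy].
    by apply: limr_ge; [exact: Fcvg|apply: nearW => k; case/andP: (FC k x Xx)].
  apply: (@ler_cvg_to nat \oo _ R (F ^~ x) (fun k => F k y * expR (C * b x y))).
  + exact: Ff.
  + by apply: cvgMl; exact: Ff.
  + apply: nearW => k; rewrite /F mulrAC ler_wpM2r ?invr_ge0 ?(ltW (M0 _ _ _))//.
    by case: (MC k) => _; apply.
- apply/cvg_lim => //; rewrite (_ : F ^~ p = fun=> 1); first exact: cvg_cst.
  by apply/funext => k; rewrite /F divff// gt_eqF// M0.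
- move=> x Xx.
  have lhs : transfer w (F k) x @[k --> \oo] --> transfer w f x.
    apply: cvg_big => [|i _]; first exact: add_continuous.
    by apply: cvgMr; apply: Ff; case: hb => hX _ _ _; exact: hX.
  have rhs : rho k p * F k.+1 x @[k --> \oo] --> limn (rho ^~ p) * f x.
    by apply: cvgM => //; move: (Ff x Xx); rewrite -cvg_shiftS.
  rewrite -(cvg_lim _ lhs)// -(cvg_lim _ rhs)//; congr (limn _).
  apply/funext => k; rewrite /F /rho.
  rewrite (_ : transfer w _ x = (M k p)^-1 * M k.+1 x); last first.
    rewrite -[M k.+1 x]/(transfer w (M k) x) -transferZ.
    by apply: eq_bigr => i _; rewrite [in RHS](mulrC (M k p)^-1).
  by field; rewrite !gt_eqF ?M0.
- move=> x Xx; rewrite (_ : (fun k => _) = F ^~ x); first exact: Ff.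
  by apply/funext => k; rewrite mulrC.
Qed.

(** Weighting the branch of return time [i.+1] by [expR (s * i.+1)] accounts for
the factor [expR s] gained on each level of its column. *)
Definition tilted w (s : R) (i : nat) (x : U) : R := expR (s * i.+1%:R) * w i x.

Lemma tilted_distorted_weight w s : distorted_weight w -> distorted_weight (tilted w s).
Proof.
move=> [w0 wd]; split=> [i x Xx|i x y Xx Xy].
  by rewrite /tilted mulr_gt0 ?expR_gt0 ?w0.
by rewrite /tilted -mulrA ler_wpM2l ?expR_ge0// wd.
Qed.

Lemma transfer_tilted_ge w s t f x : distorted_weight w -> s <= t ->
  (forall y, X y -> 0 <= f y) -> X x ->
  expR (t - s) * transfer (tilted w s) f x <= transfer (tilted w t) f x.
Proof.
case: hb => hX _ _ _ [w0 _] st f0 Xx.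
rewrite mulr_sumr ler_sum// => i _; rewrite /tilted !mulrA.
rewrite ler_wpM2r ?f0//; first exact: hX.
rewrite ler_wpM2r ?(ltW (w0 _ _ _))// -expRD ler_expR.
have : 0 <= (t - s) * i%:R by rewrite mulr_ge0 ?subr_ge0.
rewrite -natr1; lra.
Qed.

Lemma transfer_tilted_le w s t f x : distorted_weight w -> s <= t ->
  (forall y, X y -> 0 <= f y) -> X x ->
  transfer (tilted w t) f x <= expR (n%:R * (t - s)) * transfer (tilted w s) f x.
Proof.
case: hb => hX _ _ _ [w0 _] st f0 Xx.
rewrite mulr_sumr ler_sum// => i _; rewrite /tilted !mulrA.
rewrite ler_wpM2r ?f0//; first exact: hX.
rewrite ler_wpM2r ?(ltW (w0 _ _ _))// -expRD ler_expR.
have /= : (i.+1%:R : R) <= n%:R by rewrite ler_nat.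
have : 0 <= t - s by rewrite subr_ge0.
nra.
Qed.

(** Between [s] and [t] the weights grow by a factor that lies between
[expR (t - s)] and [expR (n * (t - s))], and so does the leading eigenvalue by
[eigenvalue_le].  Hence its logarithm is Lipschitz, increases with slope at
least 1, and vanishes somewhere. *)
Lemma critical_tilt w : distorted_weight w ->
  exists (s : R) (a : R^nat) (f : U -> R),
  [/\ logcone C f, f p = 1,
      forall x, X x -> transfer (tilted w s) f x = f x &
      forall x, X x ->
        (fun k => a k * iter k (transfer (tilted w s)) (fun=> 1) x) @ \oo --> f x].
Proof.
move=> gw.
have [rho rhoP] :=
  choice (fun s => transfer_eigenfunction (tilted_distorted_weight s gw)).
have rho0 s : 0 < rho s by case: (rhoP s) => a [f []].
have rho_lip s t : s <= t -> t - s <= ln (rho t) - ln (rho s) <= n%:R * (t - s).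
  move=> st.
  have [a [f [_ fC fp ff _]]] := rhoP s.
  have [a' [g [_ gC gp gf _]]] := rhoP t.
  have h1 : expR (t - s) * rho s <= rho t.
    apply: (eigenvalue_le (tilted_distorted_weight t gw) fC gC) => //.
    - by rewrite fp.
    - by rewrite gp.
    - by rewrite mulr_gt0 ?expR_gt0.
    - move=> x Xx; rewrite -mulrA -ff//; apply: transfer_tilted_ge => //.
      by case: fC.
    - by move=> x Xx; rewrite gf.
  have h2 : rho t <= expR (n%:R * (t - s)) * rho s.
    apply: (eigenvalue_le (tilted_distorted_weight t gw) gC fC) => //.
    - by rewrite gp.
    - by rewrite fp.
    - by rewrite mulr_gt0 ?expR_gt0.
    - by move=> x Xx; rewrite gf.
    - move=> x Xx; rewrite -mulrA -ff//; apply: transfer_tilted_le => //.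
      by case: fC.
  rewrite -ln_div ?posrE// -[X in X <= _ <= _]expRK
    -[X in _ && (_ <= X)]expRK.
  by rewrite !ler_ln ?posrE ?expR_gt0 ?divr_gt0// ler_pdivlMr// h1 ler_pdivrMr.
pose P s := ln (rho s).
have Pcont : continuous P.
  move=> s; apply/cvgrPdist_le => e e0.
  have n0' : (0 : R) < n%:R by rewrite ltr0n.
  exists (e / n%:R) => /=; first by rewrite divr_gt0.
  move=> t /=; rewrite ltr_pdivlMr// => dst.
  apply: le_trans (ltW dst); rewrite mulrC.
  have [st|/ltW ts] := leP s t.
    have /andP[h1 h2] := rho_lip s t st.
    rewrite [leLHS]distrC [in leRHS]distrC !ger0_norm ?subr_ge0//.
    by rewrite -subr_ge0; apply: le_trans h1; rewrite subr_ge0.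
  have /andP[h1 h2] := rho_lip t s ts.
  rewrite !ger0_norm ?subr_ge0//.
  by rewrite -subr_ge0; apply: le_trans h1; rewrite subr_ge0.
have [|||s _ Ps] := @IVT _ P (- `|P 0|) `|P 0| 0.
- by rewrite ge0_cp.
- exact: continuous_subspaceT.
- have h0 := normr_ge0 (P 0).
  have /andP[h1 _] := rho_lip _ _ h0.
  have h0' : - `|P 0| <= 0 by rewrite oppr_le0.
  have /andP[h2 _] := rho_lip _ _ h0'.
  have := ler_norm (P 0); have := ler_norm (- P 0); rewrite normrN => h3 h4.
  rewrite ge_min le_max; apply/andP; split; apply/orP; [left|right].
    by rewrite /P in h2 h3 h4 *; lra.
  rewrite /P in h1 h3 h4 *; lra.
have rho1 : rho s = 1 by rewrite -[rho s]lnK ?posrE// -/(P s) Ps expR0.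
have [a [f [_ fC fp ff fcvg]]] := rhoP s.
by exists s, a, f; split => // x Xx; rewrite ff// rho1 mul1r.
Qed.

(** If [s < t], the operator for [t] multiplies a fixed function for [s] by at
least [expR (t - s)], which [eigenvalue_le] forbids as that operator has a fixed
function of its own. *)
Lemma critical_tilt_unique w s t f g : distorted_weight w ->
  logcone C f -> logcone C g -> 0 < f p -> 0 < g p ->
  (forall x, X x -> transfer (tilted w s) f x = f x) ->
  (forall x, X x -> transfer (tilted w t) g x = g x) ->
  s = t /\ forall x, X x -> f x * g p = g x * f p.
Proof.
move=> gw.
have le_tilt s' t' u v : logcone C u -> logcone C v -> 0 < u p -> 0 < v p ->
    (forall x, X x -> transfer (tilted w s') u x = u x) ->
    (forall x, X x -> transfer (tilted w t') v x = v x) -> t' <= s'.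
  move=> uC vC up vp uf vf; rewrite leNgt; apply/negP => st.
  have : expR (t' - s') <= 1.
    apply: (eigenvalue_le (tilted_distorted_weight t' gw) uC vC) => //.
    - exact: expR_gt0.
    - move=> x Xx; rewrite -{1}uf//; apply: transfer_tilted_ge => //; first exact: ltW.
      by case: uC.
    - by move=> x Xx; rewrite vf// mul1r.
  by rewrite leNgt -expR0 ltr_expR subr_gt0 st.
move=> fC gC fp gp ff gf.
have st : s = t by apply/eqP; rewrite eq_le (le_tilt t s g f)// (le_tilt s t f g).
split=> //; rewrite -st in gf.
exact: (fixed_function_unique (tilted_distorted_weight s gw)).
Qed.

End transfer_operator.

(** * Inverse branches of an intermittent map *)

Lemma least_some (P : set nat) k :
  least P = Some k <-> P k /\ forall j, P j -> (k <= j)%N.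
Proof.
rewrite /least; split=> [|Pk].
  by case: xgetP => [_ -> [j Pj <-] [<-]|].
case: xgetP => [_ -> [j [Pj jP] <-]|/(_ (Some k))[]]; last by exists k.
by congr Some; case: Pk => Pk kP; apply/eqP; rewrite eqn_leq jP ?kP.
Qed.

Lemma least_none (P : set nat) : least P = None <-> forall k, ~ P k.
Proof.
split=> [nP k Pk|nP].
  have [k' Pk' k'P] := ex_minnP (ex_intro (fun k => `[< P k >]) k (asboolT Pk)).
  suff : least P = Some k' by rewrite nP.
  by apply/least_some; split=> [|j Pj]; [exact/asboolP|exact/k'P/asboolP].
by case E : (least P) => [k|//]; case/least_some : E => /nP.
Qed.

(** For the separation time: the first return of [return_branch i x] is [x], so
going one branch back delays the separation by one return. *)
Lemma least_shift (P Q : set nat) : ~ Q 0%N -> (forall k, Q k.+1 <-> P k) ->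
  least Q = omap S (least P).
Proof.
move=> Q0 QP; case E : (least P) => [k|] /=.
  case/least_some : E => Pk kP; apply/least_some; split; first exact/QP.
  by case=> [//|j] /QP /kP.
by move/least_none : E => nP; apply/least_none => -[//|k] /QP /nP.
Qed.

Section inverse_branches.
Variable R : realType.
Implicit Types (T S : R -> R) (x y : R).

Definition inverse_branch T (a b : R) S :=
  [/\ forall y, 0 < y < 1 -> a < S y < b /\ T (S y) = y,
      forall x, a < x < b -> 0 < T x < 1 /\ S (T x) = x,
      forall x y, 0 < x < 1 -> 0 < y < 1 -> x < y -> S x < S y &
      measurable_fun (`]0, 1[ : set R) S].

Lemma increasing_measurable (D : set R) S : is_interval D ->
  (forall x y, D x -> D y -> x < y -> S x < S y) -> measurable_fun D S.
Proof.
move=> iD Sinc mD; apply: (measurability _ (RGenOInfty.measurableE R)) => //.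
move=> _ [_ [a ->] <-]; apply: is_interval_measurable.
move=> x z [Dx Sx] [Dz Sz] y /andP[xy yz].
have Dy : D y by apply: (iD x z) => //; rewrite xy.
split=> //=; move: Sx => /=; rewrite !in_itv/= !andbT => ax.
move: xy; rewrite le_eqVlt => /predU1P[<- //|xy].
by apply: lt_trans ax _; exact: Sinc.
Qed.

Lemma increasing_branch T (a b : R) :
  (forall x, a < x < b -> derivable T x 1) ->
  (forall x, a < x < b -> 1 < derive1 T x) ->
  set_bij `]a, b[ `]0, 1[ T ->
  measurable_fun (`]a, b[ : set R) T /\ exists S, inverse_branch T a b S.
Proof.
move=> dT T1 [Tfun Tinj Tsurj].
have Tinc : {in `]a, b[ &, {homo T : x y / x < y}}.
  apply: gtr0_derive1_lt => [x|x|].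
  - by rewrite in_itv/= => /dT.
  - by rewrite in_itv/= => /T1; apply: lt_trans.
  - by apply: derivable_within_continuous => x; rewrite in_itv/= => /dT.
have ab x : (a < x < b) = (x \in `]a, b[) by rewrite in_itv.
split.
  apply: increasing_measurable; first exact: interval_is_interval.
  by move=> x y /= xab yab; exact: Tinc.
have ex y : exists x, 0 < y < 1 -> a < x < b /\ T x = y.
  have [y01|ny] := boolP (0 < y < 1); last by exists 0.
  have [x] : (T @` `]a, b[) y by apply: Tsurj; rewrite /= in_itv.
  by rewrite /= in_itv/= => xab <-; exists x.
have [S hS] := choice ex; exists S.
have T01 x : a < x < b -> 0 < T x < 1.
  by move=> xab; have := Tfun x; rewrite /= !in_itv/=; apply.
have SK x : a < x < b -> S (T x) = x.
  move=> xab; have [Sab TS] := hS _ (T01 _ xab).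
  by apply: Tinj => //; rewrite inE /= in_itv.
have Sinc x y : 0 < x < 1 -> 0 < y < 1 -> x < y -> S x < S y.
  move=> x01 y01 xy.
  have [Sx TSx] := hS x x01; have [Sy TSy] := hS y y01.
  rewrite ltNge le_eqVlt; apply/negP => /predU1P[eS|SS].
    by move: xy; rewrite -TSx -TSy eS ltxx.
  have := Tinc (S y) (S x); rewrite !in_itv/= => /(_ Sy Sx SS).
  by rewrite TSx TSy => /(lt_trans xy); rewrite ltxx.
split=> //; first by move=> x xab; split; [exact: T01|exact: SK].
apply: increasing_measurable; first exact: interval_is_interval.
by move=> x y /=; rewrite !in_itv/=; exact: Sinc.
Qed.

Definition two_branched x0 T S0 S1 :=
  [/\ 0 < x0 < 1, forall x, 0 <= x <= 1 -> 0 <= T x <= 1,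
      measurable_fun (`[0, 1] : set R) T,
      inverse_branch T 0 x0 S0 & inverse_branch T x0 1 S1].

Lemma pomeau_manneville_branches alpha x0 T : pomeau_manneville alpha x0 T ->
  exists S0 S1, two_branched x0 T S0 S1.
Proof.
move=> [[_ x01 T01 _] [bij0 bij1 [C21 C20] T0 T1]].
have d0 x : 0 < x < x0 -> derivable T x 1.
  move=> /andP[x0' xx0]; have [||//] := C20 (x / 2) _ x; first by rewrite divr_gt0.
  by rewrite /= in_itv/= xx0 andbT ltr_pdivrMr// mulr_natr mulr2n ltrDl.
have d1 x : x0 < x < 1 -> derivable T x 1.
  by move=> xx; have [] := C21 x _; rewrite //= in_itv.
have [m0 [S0 hS0]] := increasing_branch d0 T0 bij0.
have [m1 [S1 hS1]] := increasing_branch d1 T1 bij1.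
exists S0, S1; split=> //.
have -> : `[0, 1]%classic = [set 0; x0; 1] `|` (`]0, x0[ `|` `]x0, 1[) :> set R.
  apply/seteqP; case/andP: x01 => p0 p1; split=> x /=; rewrite !in_itv/=.
    move=> /andP[h0 h1].
    have [->|x0'] := eqVneq x 0; first by left; left; left.
    have [->|x1'] := eqVneq x 1; first by left; right.
    have xp : 0 < x by rewrite lt_neqAle eq_sym x0'.
    have x1 : x < 1 by rewrite lt_neqAle x1'.
    by have [xx|xx|->] := ltgtP x x0; [right; left|right; right|left; left; right];
       rewrite ?xp.
  by move=> [[[->|->]|->]|[/andP[] h1 h2|/andP[] h1 h2]]; lra.
apply/measurable_funU; [| |split; last exact/measurable_funU].
- by apply: measurableU; [apply: measurableU|].
- exact: measurableU.
move=> _ Y _; apply: countable_measurable => [t|]; first exact: measurable_set1.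
by apply: sub_countable (_ : countable [set 0; x0; 1]);
  [apply: subset_card_le; exact: subIsetl|exact: finite_set_countable].
Qed.

End inverse_branches.

Section tower_branches.
Variables (R : realType) (x0 : R) (T S0 S1 : R -> R).
Hypothesis hB : two_branched x0 T S0 S1.

Let x01 : 0 < x0 < 1. Proof. by case: hB. Qed.
Let T01 x : 0 <= x <= 1 -> 0 <= T x <= 1. Proof. by case: hB => _ h *; exact: h. Qed.
Let mT : measurable_fun (`[0, 1] : set R) T. Proof. by case: hB. Qed.
Let hS0 : inverse_branch T 0 x0 S0. Proof. by case: hB. Qed.
Let hS1 : inverse_branch T x0 1 S1. Proof. by case: hB. Qed.

Implicit Types (x y : R).

Local Notation base_cell := (base_cell x0 T).
Local Notation return_time := (return_time x0 T).

(** The first return to the base occurs at time [i.+1], by one step of [T] on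
]x0, 1[ followed by [i] steps on ]0, x0[. *)
Definition return_branch (i : nat) y : R := S1 (iter i S0 y).

Lemma iter_S0_01 i y : 0 < y < 1 -> 0 < iter i S0 y < 1.
Proof.
case: hS0 => h _ _ _; elim: i => //= i IH /IH /h[/andP[-> /lt_trans]] + _.
by case/andP: x01 => _ p1 /(_ _ p1) ->.
Qed.

Lemma iter_T_S0 i j y : 0 < y < 1 -> (j <= i)%N ->
  iter j T (iter i S0 y) = iter (i - j) S0 y.
Proof.
move=> y01; elim: j i => [|j IH] [|i]//; rewrite ltnS subSS => ji.
rewrite iterSr iterS; case: hS0 => h _ _ _.
by have [_ ->] := h _ (iter_S0_01 i y01); exact: IH.
Qed.

Lemma return_timeP x r : return_time x = Some r <->
  [/\ (0 < r)%N, x0 < iter r T x < 1 &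
      forall j, (0 < j < r)%N -> ~ (x0 < iter j T x < 1)].
Proof.
split=> [/least_some[[r0 rx] rmin]|[r0 rx rmin]].
  split=> // j /andP[j0 jr] jx; have := rmin j (conj j0 jx).
  by rewrite leqNgt jr.
apply/least_some; split=> // j [j0 jx]; rewrite leqNgt; apply/negP => jr.
by apply: (rmin j); rewrite ?j0.
Qed.

Lemma return_branch_mem i x : 0 < x < 1 -> x0 < return_branch i x < 1.
Proof. by case: hS1 => h _ _ _ x1; have [] := h _ (iter_S0_01 i x1). Qed.

Lemma iter_T_branch i x : 0 < x < 1 -> iter i.+1 T (return_branch i x) = x.
Proof.
move=> x1; case: hS1 => h _ _ _; rewrite iterSr.
by have [_ ->] := h _ (iter_S0_01 i x1); rewrite iter_T_S0// subnn.
Qed.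

Lemma base_in_unit x : x0 < x < 1 -> 0 < x < 1.
Proof.
by case/andP: x01 => p0 _ /andP[/(lt_trans p0) -> ->].
Qed.

Lemma base_cell_branch i x : x0 < x < 1 -> base_cell i.+1 (return_branch i x).
Proof.
move=> xx; have x1 := base_in_unit xx.
split; first by have /andP[/ltW -> /ltW ->] := return_branch_mem i x1.
apply/return_timeP; split=> //; first by rewrite iter_T_branch.
move=> [|j]// /andP[_ ji'].
have ji : (j < i)%N by [].
rewrite iterSr.
case: hS1 => h _ _ _; have [_ ->] := h _ (iter_S0_01 i x1).
rewrite iter_T_S0//; last exact: ltnW.
case E : (i - j)%N => [|k]; first by move/eqP: E; rewrite subn_eq0 leqNgt ji.
case: hS0 => g _ _ _; have [/andP[_ gx] _] := g _ (iter_S0_01 k x1).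
by rewrite iterS; move=> /andP[/lt_trans/(_ gx)]; rewrite ltxx.
Qed.

(** The orbits of the points at which the branches of [T] meet.  There [T] may
take any value, so these orbits could create spurious preimages under the first
return map. *)
Definition singular_orbit : set R :=
  \bigcup_k (iter k T @` [set 0; x0; 1]).

Lemma countable_singular_orbit : countable singular_orbit.
Proof.
apply: bigcup_countable => // k _; apply: finite_set_countable.
exact: finite_image.
Qed.

Lemma iter_T01 k x : 0 <= x <= 1 -> 0 <= iter k T x <= 1.
Proof. by elim: k => //= k IH /IH /T01. Qed.

(** An orbit that ends outside [singular_orbit] has avoided 0, [x0] and 1, so the
return time tells which branch of [T] is applied at each step. *)
Lemma cell_preimage r x y : base_cell r y -> iter r T y = x ->
  ~ singular_orbit x -> exists2 i, r = i.+1 & y = return_branch i x.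
Proof.
move=> [/andP[y0 y1] /return_timeP[r0 rx rmin]] Tx xO.
have y01 : 0 <= y <= 1 by case/andP: x01 => p0 _; rewrite y1 (le_trans (ltW p0)).
have reg j : (j <= r)%N -> 0 < iter j T y < x0 \/ x0 < iter j T y < 1.
  move=> jr; have /andP[h0 h1] := iter_T01 j y01.
  have xE : iter (r - j) T (iter j T y) = x by rewrite -iterD subnK.
  have n0 : iter j T y != 0.
    by apply/eqP => E; apply: xO; exists (r - j)%N => //;
    exists 0; [left; left|rewrite -E].
  have n1 : iter j T y != 1.
    by apply/eqP => E; apply: xO; exists (r - j)%N => //; exists 1; [right|rewrite -E].
  have nx : iter j T y != x0.
    by apply/eqP => E; apply: xO; exists (r - j)%N => //;
    exists x0; [left; right|rewrite -E].
  have p0 : 0 < iter j T y by rewrite lt_neqAle eq_sym n0.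
  have p1 : iter j T y < 1 by rewrite lt_neqAle n1.
  rewrite p0 p1 andbT; by case: ltgtP nx => // ? _; [left|right].
case: r r0 rx rmin Tx reg => // r _ rx rmin Tx reg.
exists r => //.
have TyE j : (j <= r)%N -> T y = iter j S0 (iter j T (T y)).
  elim: j => // j IH jr.
  (* The intermediate points are below [x0], where [S0] undoes [T]. *)
  have SE : S0 (iter j.+1 T (T y)) = iter j T (T y).
    rewrite iterS -iterSr; case: hS0 => _ h _ _.
    case: (reg j.+1 (ltnW jr)) => [/h[]//|].
    by move=> E; case: (rmin j.+1 jr E).
  by rewrite iterSr SE -IH// ltnW.
rewrite /return_branch -Tx iterSr -TyE//.
case: hS1 => _ h _ _; case: (reg 0%N) => //= [/andP[_]|/h[_ ->//]].
by rewrite ltNge y0.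
Qed.

Lemma measurable_iter_T k : measurable_fun (`[0, 1] : set R) (iter k T).
Proof.
elim: k => [|k IH]; first exact: measurable_id.
rewrite (_ : iter k.+1 T = T \o iter k T)//.
apply: (measurable_comp (F := `[0, 1]%classic : set R)) => //.
move=> _ [x /= x1 <-]; move: x1; rewrite !in_itv/=; exact: iter_T01.
Qed.

Lemma measurable_base_cell r : measurable (base_cell r).
Proof.
pose A j : set R := `[0, 1] `&` iter j T @^-1` `]x0, 1[.
have mA j : measurable (A j) by apply: measurable_iter_T.
have -> : base_cell r = `[x0, 1] `&` (if (0 < r)%N then A r else set0) `\`
    \bigcup_(j in [set j | (0 < j < r)%N]) A j.
  apply/seteqP; split=> x.
  - move=> [x1 /return_timeP[r0 rx rmin]]; rewrite r0.
    have x1' : x \in `[0, 1].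
      by case/andP: x01 x1 => p0 _ /andP[q0 q1]; rewrite in_itv/= q1 (le_trans (ltW p0)).
    split; first by split; [rewrite /= in_itv|split=> //=; rewrite in_itv].
    by move=> [j /= jr [_ /=]]; rewrite in_itv/=; exact: rmin.
  - case: (posnP r) => [->|r0] [[x1 //] [x1' /=]]; rewrite in_itv/= => rx nj.
    move: x1; rewrite /= in_itv/= => x1.
    split=> //; apply/return_timeP; split=> // j jr jx; apply: nj.
    by exists j => //; split=> //=; rewrite in_itv.
apply: measurableD.
  by apply: measurableI => //; case: ifP.
exact: bigcup_measurable.
Qed.

Lemma measurable_branch i : measurable_fun (`]0, 1[ : set R) (return_branch i).
Proof.
have m0 : measurable_fun (`]0, 1[ : set R) (iter i S0).
  elim: i => [|i IH]; first exact: measurable_id.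
  case: hS0 => _ _ _ m.
  rewrite (_ : iter i.+1 S0 = S0 \o iter i S0)//.
  apply: (measurable_comp (F := `]0, 1[%classic : set R)) => //.
  by move=> _ [x /= x1 <-]; move: x1; rewrite !in_itv/=; exact: iter_S0_01.
case: hS1 => _ _ _ m.
rewrite (_ : return_branch i = S1 \o iter i S0)//.
apply: (measurable_comp (F := `]0, 1[%classic : set R)) => //.
by move=> _ [x /= x1 <-]; move: x1; rewrite !in_itv/=; exact: iter_S0_01.
Qed.

Lemma first_return_branch i x : x0 < x < 1 ->
  first_return x0 T (return_branch i x) = x.
Proof.
move=> xx; have [_] := base_cell_branch i xx.
by rewrite /first_return => ->; rewrite iter_T_branch// base_in_unit.
Qed.

Lemma sep_time_base_branch i x y : x0 < x < 1 -> x0 < y < 1 ->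
  sep_time_base x0 T (return_branch i x) (return_branch i y) =
  omap S (sep_time_base x0 T x y).
Proof.
move=> xx yy; apply: least_shift.
  by apply; exists i.+1; split; exact: base_cell_branch.
by move=> k; rewrite /= -!iterS !iterSr !first_return_branch.
Qed.

Lemma sep_time_baseC x y : sep_time_base x0 T x y = sep_time_base x0 T y x.
Proof.
congr least; apply/seteqP; split=> k /= h [i [hx hy]]; apply: h; by exists i.
Qed.

Lemma beta_pow_ge0_le1 (beta : R) s : 0 < beta < 1 -> 0 <= beta_pow beta s <= 1.
Proof.
move=> /andP[/ltW b0 /ltW b1]; case: s => [k|] /=; last by rewrite lexx ler01.
by rewrite exprn_ge0//= exprn_ile1.
Qed.

Lemma beta_pow_shift (beta : R) s :
  beta_pow beta (omap S s) = beta * beta_pow beta s.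
Proof. by case: s => [k|] /=; rewrite ?exprS ?mulr0. Qed.

End tower_branches.

(** * Null sets of the tower *)

Section tower_measure.
Variable R : realType.
Local Notation leb := (@lebesgue_measure R).
Implicit Types (B : set (measurableTypeR R)) (N : set (tower_space R)).

Lemma mu_slice B l : measurable B -> mu R (B `*` [set l]) = leb B.
Proof.
move=> mB; have ml : measurable [set l] by [].
apply: etrans (product_measure1E leb (@counting nat R) mB ml) _.
have l1 : @counting nat R [set l] = 1%E.
  by rewrite /counting asboolT// fset_set1 finmap.cardfs1.
exact: etrans (congr1 (fun a => leb B * a)%E l1) (mule1 _).
Qed.

Lemma mu_null_cylinder B : measurable B -> leb B = 0%E ->
  mu R (B `*` setT) = 0%E.
Proof.
move=> mB B0; apply: etrans (product_measure1E leb (@counting nat R) mB measurableT) _.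
exact: etrans (congr1 (fun a => a * _)%E B0) (mul0e _).
Qed.

Lemma null_negligible B : measurable B -> leb B = 0%E -> leb.-negligible B.
Proof. by move=> mB B0; exists B; split. Qed.

Lemma negligible_null B : measurable B -> leb.-negligible B -> leb B = 0%E.
Proof. by move=> mB h; exact: (proj1 (negligibleP leb mB) h). Qed.

Lemma negligible_cylinder B : leb.-negligible B ->
  (mu R).-negligible [set z | B z.1].
Proof.
move=> [A [mA A0 BA]]; exists (A `*` setT); split.
- exact: measurableX.
- exact: mu_null_cylinder.
- by move=> z /= /BA.
Qed.

(** An exceptional set of the tower is discarded together with all the columns
that it meets; as there are countably many levels, this costs a null set of
base points. *)
Lemma negligible_slices N : (mu R).-negligible N ->
  exists B, [/\ measurable B, leb B = 0%E & forall z, N z -> B z.1].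
Proof.
move=> [A [mA A0 NA]]; exists (\bigcup_l ysection A l).
have mY l : measurable (ysection A l) by exact: measurable_ysection.
split; first exact: bigcupT_measurable.
- apply: negligible_null; first exact: bigcupT_measurable.
  apply: negligible_bigcup => l; apply: null_negligible => //.
  have h : (mu R (ysection A l `*` [set l]) <= mu R A)%E.
    rewrite le_measure ?inE//; first exact: measurableX.
    by move=> [x k] [/=]; rewrite /ysection/= inE => Axl ->.
  move: h; rewrite A0 mu_slice// => h.
  by apply/eqP; rewrite eq_le; apply/andP; split; [exact: h|exact: measure_ge0].
- by move=> [x l] /NA Axl; exists l => //; rewrite /ysection/= inE.
Qed.

End tower_measure.

Section tower_jacobian.
Variables (R : realType) (x0 : R) (T S0 S1 : R -> R).
Hypothesis hB : two_branched x0 T S0 S1.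
Variable JF : tower_space R -> R.
Hypothesis hJF : is_jacobian x0 T JF.
Local Notation leb := (@lebesgue_measure R).
Local Notation h := (return_branch S0 S1).
Local Notation tower := (tower x0 T).
Local Notation cell := (cell x0 T).
Local Notation base_cell := (base_cell x0 T).

Lemma cellE l i : (l < i)%N -> cell l i = base_cell i `*` [set l].
Proof. by move=> li; apply/seteqP; split=> z /=; rewrite /cell/=; tauto. Qed.

Lemma measurable_cell l i : measurable (cell l i).
Proof.
have [li|il] := ltnP l i.
  by rewrite cellE//; apply: measurableX => //; exact: (measurable_base_cell hB).
rewrite (_ : cell l i = set0)//; apply/seteqP; split=> z //= [].
by rewrite ltnNge il.
Qed.

Lemma cell_tower l i : cell l i `<=` tower.
Proof. by move=> z [li [zi zl]]; exists i; rewrite ?zl. Qed.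

Lemma measurable_tower : measurable tower.
Proof.
have -> : tower = \bigcup_i \bigcup_l cell l i.
  apply/seteqP; split=> z.
    by move=> [i zi li]; exists i => //; exists z.2.
  by move=> [i _ [l _ /cell_tower]].
by apply: bigcupT_measurable => i; apply: bigcupT_measurable => l; exact: measurable_cell.
Qed.

Lemma measurable_JF : measurable_fun tower JF. Proof. by case: hJF. Qed.

(** On these levels [tower_map] is a translation upwards, which preserves the
measure. *)
Lemma jacobian_below_top l i : (l.+1 < i)%N ->
  (mu R).-negligible [set z | cell l i z /\ JF z <> 1].
Proof.
move=> li; have li' : (l < i)%N by exact: ltnW.
have mC := measurable_cell l i.
have mJ : measurable_fun (cell l i) (EFin \o JF).
  apply/measurable_EFinP; apply: measurable_funS measurable_JF.
    exact: measurable_tower.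
  exact: cell_tower.
have C1 : (mu R).-integrable (cell l i) (cst 1%E).
  apply/integrableP; split; first exact: measurable_cst.
  rewrite (eq_integral (cst 1%E)); last by move=> z _; rewrite /= normr1.
  rewrite integral_cst// mul1e cellE// mu_slice; last exact: (measurable_base_cell hB).
  apply: (@le_lt_trans _ _ (leb `[0, 1]%classic)).
    rewrite le_measure ?inE//; first exact: (measurable_base_cell hB).
    move=> x [/andP[xx x1] _]; rewrite /= in_itv/= x1 andbT.
    by case: hB => /andP[p0 _] _ _ _ _; rewrite (le_trans (ltW p0)).
  by rewrite lebesgue_measure_itv/= lte_fin ltr01 oppr0 adde0 ltry.
have := @integral_ae_eq _ _ _ (mu R) _ mC _ _ C1 mJ.
case=> [E EC mE|A [mA A0 CA]]; last first.
  exists A; split=> //; apply: subset_trans CA => z /= [Cz Jz] /(_ Cz) [] /esym.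
  exact: Jz.
rewrite integral_cst// mul1e; case: hJF => _ /(_ _ _ _ mE EC) <-.
have EE : E = ysection E l `*` [set l].
  apply/seteqP; split=> [[x k] Exk|[x k] [/= + ->]].
    have [_ [_ /= kl]] := EC _ Exk; rewrite kl in Exk *.
    by split=> //=; rewrite /ysection/= inE.
  by rewrite /ysection/= inE.
have mEl : measurable (ysection E l) by exact: measurable_ysection.
rewrite /nu [X in mu R X = _]EE mu_slice//.
rewrite (_ : _ `&` _ = ysection E l `*` [set l.+1]) ?mu_slice//.
apply/seteqP; split.
  move=> _ [[[x k] Exk <-] _].
  have [_ [[_ /= rx] /= kl]] := EC _ Exk; rewrite kl in Exk *.
  rewrite /tower_map/= rx; case: ifPn => [_|]; last first.
    by rewrite -(ltn_add2r 1) !addn1 prednK ?li// (ltn_trans _ li).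
  by split=> //=; rewrite /ysection/= inE.
move=> [x k] [/=]; rewrite /ysection/= inE => Exl ->.
have [_ [xi /= _]] := EC _ Exl; split; last by exists i.
exists (x, l) => //; case: xi => _ /= rx; rewrite /tower_map/= rx.
by rewrite -ltnS prednK ?li// (ltn_trans _ li).
Qed.

Definition returning : set R := `]x0, 1[ `&` \bigcup_i base_cell i.

Lemma measurable_returning : measurable returning.
Proof.
apply: measurableI => //; apply: bigcupT_measurable => i.
exact: (measurable_base_cell hB).
Qed.

Lemma returning01 x : returning x -> x0 < x < 1.
Proof. by case; rewrite /= in_itv. Qed.

Lemma returning_branch i x : x0 < x < 1 -> returning (h i x).
Proof.
move=> xx; split; last by exists i.+1 => //; exact: (base_cell_branch hB).
by rewrite /= in_itv/=; exact/(return_branch_mem hB)/(base_in_unit hB).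
Qed.

(** The image of [h i] is described through the forward map, in order to be
visibly measurable. *)
Definition branch_image i : set R :=
  [set y | [/\ x0 < y < 1, x0 < iter i.+1 T y < 1 & h i (iter i.+1 T y) = y]].

Lemma measurable_branch_image i : measurable (branch_image i).
Proof.
have x01 : 0 < x0 < 1 by case: hB.
pose D : set R := `]x0, 1[ `&` iter i.+1 T @^-1` `]x0, 1[.
have mTi : measurable_fun (`]x0, 1[ : set R) (iter i.+1 T).
  apply: measurable_funS (measurable_iter_T hB i.+1) => //.
  by move=> y /=; rewrite !in_itv/= => /(base_in_unit hB)/andP[/ltW -> /ltW ->].
have mD : measurable D by exact: mTi.
have mhT : measurable_fun D (h i \o iter i.+1 T).
  apply: (measurable_comp (F := `]0, 1[%classic : set R)) => //.
  - move=> _ [y [_ +] <-]; rewrite /= !in_itv/=; exact: (base_in_unit hB).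
  - exact: (measurable_branch hB).
  - by apply: measurable_funS mTi => //; exact: subIsetl.
have -> : branch_image i = D `&` [set y | (h i \o iter i.+1 T) y = y].
  apply/seteqP; split=> y /=.
    by move=> [h1 h2 h3]; split=> //; split; rewrite /= in_itv.
  by move=> [[]]; rewrite /= !in_itv/=.
rewrite (_ : _ `&` _ = D `&` (fun y => (h i \o iter i.+1 T) y - y) @^-1` [set 0]).
  by apply: measurable_funB => //; exact: measurable_id.
apply/seteqP; split=> y [Dy hy]; split=> //; apply/eqP.
  by rewrite subr_eq0; apply/eqP.
by rewrite -subr_eq0; apply/eqP.
Qed.

Lemma branch_imageP i y : branch_image i y -> base_cell i.+1 y.
Proof. by move=> [_ Tyx <-]; exact: (base_cell_branch hB). Qed.

Lemma branch_image_branch i x : x0 < x < 1 -> branch_image i (h i x).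
Proof.
move=> xx; have x1 := base_in_unit hB xx.
by split; rewrite ?(iter_T_branch hB)//; exact: (return_branch_mem hB).
Qed.

Lemma measurable_top_jacobian i :
  measurable_fun (branch_image i) (fun y => JF (y, i)).
Proof.
apply: (measurable_comp (F := tower)).
- exact: measurable_tower.
- by move=> _ [y /branch_imageP yi <-]; exists i.+1.
- exact: measurable_JF.
- by apply: measurable_funTS; exact: measurable_pair2.
Qed.

Lemma measurable_branch_returning i : measurable_fun (returning : set R) (h i).
Proof.
apply: measurable_funS (measurable_branch hB i) => //.
by move=> y /returning01 /(base_in_unit hB); rewrite /= in_itv.
Qed.

(** The map [tower_map] sends the part of the top of column [i.+1] that lies over
[B] and over the image of [h i] onto the base points [x] with [B (h i x)].
Restriction to [returning] comes from [nu], which only sees the tower. *)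
Lemma branch_preimage_measure i (B : set R) : measurable B ->
  leb (returning `&` h i @^-1` B) =
  (\int[mu R]_(z in (B `&` branch_image i) `*` [set i]) (JF z)%:E)%E.
Proof.
move=> mB; have mBi : measurable (B `&` branch_image i).
  by apply: measurableI => //; exact: measurable_branch_image.
have mA : measurable ((B `&` branch_image i) `*` [set i]) by exact: measurableX.
have AC : (B `&` branch_image i) `*` [set i] `<=` cell i i.+1.
  by move=> [y k] [/= [_ /branch_imageP yi] ->].
case: hJF => _ /(_ _ _ _ mA AC) <-.
have mh := @measurable_branch_returning i.
rewrite -(mu_slice 0); last exact: (mh measurable_returning).
rewrite /nu; congr (mu R _); apply/seteqP; split.
- move=> [x k] [/= [Vx Bx] ->]; have xx := returning01 Vx.
  split; last first.
    case: Vx => _ [r _ rx]; exists r => //=.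
    by case: rx => _ /(return_timeP x0 T)[].
  exists (h i x, i); first by split=> //; split=> //; exact: branch_image_branch.
  rewrite /tower_map [(_, _).1]/=; have [_ ->] := base_cell_branch hB i xx.
  by rewrite ltnn (iter_T_branch hB)// (base_in_unit hB).
- move=> _ [[[y k] [/= [By yi] ->] <-]].
  have [_ ry] := branch_imageP yi; case: (yi) => yy Tyx hTy.
  rewrite /tower_map/= ry /= ltnn => -[r xr _]; split=> //.
  split=> /=; last by rewrite hTy.
  split; first by rewrite /= in_itv.
  by exists r.
Qed.

Lemma branch_preimage_null i (B : set R) : leb.-negligible B ->
  leb.-negligible (returning `&` h i @^-1` B).
Proof.
move=> [A [mA A0 BA]].
apply: (@negligibleS _ _ _ leb (returning `&` h i @^-1` A)).
  by move=> x [Vx /BA].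
apply: null_negligible; last (rewrite branch_preimage_measure//; apply: null_set_integral).
- by have mh := @measurable_branch_returning i; exact: (mh measurable_returning).
- apply: measurableX => //; apply: measurableI => //; exact: measurable_branch_image.
- apply/measurable_EFinP; apply: measurable_funS measurable_JF.
    exact: measurable_tower.
  by move=> [y k] [/= [_ /branch_imageP yi] ->]; exists i.+1.
- have mAi : measurable (A `&` branch_image i).
    by apply: measurableI => //; exact: measurable_branch_image.
  rewrite mu_slice//.
  have h : (leb (A `&` branch_image i) <= leb A)%E.
    by apply: le_measure; rewrite ?inE//; exact: subIsetl.
  rewrite A0 in h.
  by apply/eqP; rewrite eq_le; apply/andP; split; [exact: h|exact: measure_ge0].
Qed.

(** The zeros of the Jacobian in a top cell are mapped to a set whose measure is
the integral of 0. *)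
Lemma jacobian_top_neq0 i :
  leb.-negligible [set x | returning x /\ JF (h i x, i) = 0].
Proof.
pose B : set R := [set y | branch_image i y /\ JF (y, i) = 0].
have mJi := @measurable_top_jacobian i.
have mB : measurable B.
  rewrite (_ : B = branch_image i `&` (fun y => JF (y, i)) @^-1` [set 0])//.
  by apply: mJi => //; exact: measurable_branch_image.
have mh := @measurable_branch_returning i.
apply: (@negligibleS _ _ _ leb (returning `&` h i @^-1` B)).
  move=> x [Vx J0]; split=> //; split=> //.
  exact/branch_image_branch/returning01.
apply: null_negligible; first exact: (mh measurable_returning).
rewrite branch_preimage_measure//; apply: integral0_eq => -[y k] [/= [[_ J0] _] ->].
by rewrite J0.
Qed.

(** Sets of base points on which the almost everywhere properties of the tower
hold everywhere, and which the inverse branches preserve, so that the transfer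
operator acts on functions defined there. *)
Record regular (X : set R) : Prop := Regular {
  regular_measurable : measurable X;
  regular_returning : X `<=` returning;
  regular_branch : forall i x, X x -> X (h i x);
  regular_nonsingular : forall x, X x -> ~ singular_orbit x0 T x;
  regular_below_top : forall x l i, X x -> base_cell i x -> (l.+1 < i)%N ->
    JF (x, l) = 1;
  regular_top : forall x i, X x -> JF (h i x, i) != 0;
  regular_conull : (mu R).-negligible [set z | tower z /\ ~ X z.1]
}.

(** Add to [N] its preimages under all compositions of the branches. *)
Lemma negligible_saturation (N : set R) : leb.-negligible N ->
  exists X : set R, [/\ measurable X, X `<=` returning `\` N,
    forall i x, X x -> X (h i x) & leb.-negligible (returning `\` X)].
Proof.
move=> [A [mA A0 NA]].
pose E := fix E k := if k is k'.+1
  then E k' `|` \bigcup_i (returning `&` h i @^-1` E k') else A.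
have mE k : measurable (E k).
  elim: k => //= k IH; apply: measurableU => //; apply: bigcupT_measurable => i.
  by have mh := @measurable_branch_returning i; exact: (mh measurable_returning).
have E0 k : leb.-negligible (E k).
  elim: k => [|k IH] /=; first exact: null_negligible.
  apply: negligibleU => //; apply: negligible_bigcup => i.
  exact: branch_preimage_null.
exists (returning `\` \bigcup_k E k); split.
- by apply: measurableD; [exact: measurable_returning|exact: bigcupT_measurable].
- by move=> x [Vx nE]; split=> // Nx; apply: nE; exists 0%N => //; exact: NA.
- move=> i x [Vx nE]; split; first exact/returning_branch/returning01.
  by move=> [k _ Ek]; apply: nE; exists k.+1 => //=; right; exists i.
- apply: negligibleS (negligible_bigcup E0) => x [Vx].
  by move=> /not_andP[//|/contrapT].
Qed.

Lemma regular_exists (N : set (tower_space R)) : (mu R).-negligible N ->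
  exists X, regular X /\ forall z, X z.1 -> ~ N z.
Proof.
move=> N0.
have [N' [mN' N'0 NN']] := negligible_slices N0.
pose J1 := \bigcup_i \bigcup_l
  [set z | (l.+1 < i)%N /\ cell l i z /\ JF z <> 1].
have J10 : (mu R).-negligible J1.
  apply: negligible_bigcup => i; apply: negligible_bigcup => l.
  have [li|il] := ltnP l.+1 i.
    by apply: negligibleS (jacobian_below_top li) => z [].
  by apply: negligibleS (negligible_set0 _) => z [].
have [J1' [mJ1' J1'0 JJ1']] := negligible_slices J10.
pose J2 := \bigcup_i [set x | returning x /\ JF (h i x, i) = 0].
have J20 : leb.-negligible J2.
  by apply: negligible_bigcup => i; exact: jacobian_top_neq0.
have O0 : leb.-negligible (singular_orbit x0 T).
  apply: null_negligible.
    apply: countable_measurable; last exact: countable_singular_orbit.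
    by move=> t; exact: measurable_set1.
  exact/countable_lebesgue_measure0/countable_singular_orbit.
have [X [mX XN Xh X0]] : exists X : set R, [/\ measurable X,
    X `<=` returning `\` (N' `|` J1' `|` J2 `|` singular_orbit x0 T),
    forall i x, X x -> X (h i x) & leb.-negligible (returning `\` X)].
  apply: negligible_saturation; apply: negligibleU => //; apply: negligibleU => //.
  by apply: negligibleU; exact: null_negligible.
exists X; split; last first.
  by move=> z /XN[_ nN] /NN' Nz; apply: nN; left; left; left.
split=> //.
- by move=> x /XN[].
- by move=> x /XN[_ nN] Ox; apply: nN; right.
- move=> x l i /XN[_ nN] xi li; apply: contrapT => J; apply: nN.
  left; left; right; apply: (JJ1' (x, l)).
  exists i => //; exists l => //; split=> //; split=> //; split=> //; exact: ltnW.
- move=> x i /XN[Vx nN]; apply/eqP => J; apply: nN; left; right.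
  by exists i.
- have e0 : leb.-negligible [set x0; 1].
    apply: null_negligible; last exact/countable_lebesgue_measure0/finite_set_countable.
    by apply: measurableU; exact: measurable_set1.
  apply: negligibleS (negligible_cylinder (negligibleU X0 e0)).
  move=> [x k] [[i /= [/andP[x0x x1] rx] _] nX].
  have xi : base_cell i x by split=> //; rewrite x0x.
  have [->|n0] := eqVneq x x0; first by right; left.
  have [->|n1] := eqVneq x 1; first by right; right.
  left; split=> //; split; last by exists i.
  by rewrite /= in_itv/= !lt_neqAle x0x x1 eq_sym n0 n1.
Qed.

(** The points between [S1 x0] and 1 return at once. *)
Lemma base_cell1_measure_gt0 : (0 < leb (base_cell 1))%E.
Proof.
case: (hB) => x01 _ _ _ [S1P S1K S1inc _].
have [/andP[a0 a1] _] := S1P _ x01.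
apply: (@lt_le_trans _ _ (leb `]S1 x0, 1[%classic)).
  by rewrite lebesgue_measure_itv/= lte_fin a1 -EFinD lte_fin subr_gt0.
rewrite le_measure ?inE//; first exact: (measurable_base_cell hB).
move=> y /=; rewrite in_itv/= => /andP[Sy y1].
have yx : x0 < y < 1 by rewrite (lt_trans a0 Sy).
have [Ty SK] := S1K _ yx.
split; first by case/andP: yx => /ltW -> /ltW ->.
apply/(return_timeP x0 T); split=> //=; last by case=> [|[|]].
case/andP: (Ty) => _ ->; rewrite andbT ltNge le_eqVlt; apply/negP => /predU1P[e|l].
  by move: Sy; rewrite -SK e ltxx.
have := S1inc _ _ Ty x01 l; rewrite SK => /(lt_trans Sy); by rewrite ltxx.
Qed.

Lemma regular_nonempty X : regular X -> exists x, X x.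
Proof.
move=> rX; apply/set0P/eqP => X0.
have [B [mB B0 TB]] := negligible_slices (regular_conull rX).
have := base_cell1_measure_gt0; rewrite -B0 ltNge => /negP; apply.
rewrite le_measure ?inE//; first exact: (measurable_base_cell hB).
by move=> x x1; apply: (TB (x, 0%N)); rewrite X0; split=> //; exists 1%N.
Qed.

End tower_jacobian.

(** * Eigenfunctions of the conditional operator *)

Section modification.
Context d (S : measurableType d) (R : realType).
Variable m : {measure set S -> \bar R}.
Import HBNNSimple.

(** Here [f] is typically the result of the conditional operator, whose values are
known only up to a null set.  A simple function below [f] is, up to a null set,
also below [g]. *)
Lemma ge0_integral_ae_modification (D : set S) (f g : S -> \bar R) :
  measurable D -> measurable_fun D g ->
  (forall x, D x -> 0 <= f x)%E -> (forall x, D x -> 0 <= g x)%E ->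
  ae_eq m D f g -> (\int[m]_(x in D) f x = \int[m]_(x in D) g x)%E.
Proof.
move=> mD mg f0 g0 [N [mN N0 fgN]].
pose f1 := f \_ D; pose g1 := g \_ D.
have mg1 : measurable_fun setT g1 by exact/(measurable_restrictT _ _).1.
have f10 x : (0 <= f1 x)%E by exact: erestrict_ge0.
have g10 x : (0 <= g1 x)%E by exact: erestrict_ge0.
have fg1 x : ~ N x -> f1 x = g1 x.
  move=> Nx; rewrite /f1 /g1 /patch; case: ifPn => //; rewrite inE => Dx.
  by apply: contrapT => fg; apply: Nx; apply: fgN => /= /(_ Dx).
have g2E : (\int[m]_x g1 x = \int[m]_x (g1 \_ (~` N)) x)%E.
  apply: ge0_ae_eq_integral => //.
  - by apply/(measurable_restrictT _ (measurableC mN)).1; exact: measurable_funTS.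
  - by move=> x _; exact: erestrict_ge0.
  - exists N; split=> // x /= /not_implyP[_]; apply: contra_notP => Nx.
    by rewrite /patch ifT// inE.
rewrite integral_mkcond [RHS]integral_mkcond -/f1 -/g1.
apply/eqP; rewrite eq_le; apply/andP; split.
- rewrite ge0_integralTE//; apply: ge_ereal_sup => _ [s /= sf <-].
  rewrite -integralT_nnsfun.
  have ms : measurable_fun setT (EFin \o s) by exact/measurable_EFinP.
  have -> : (\int[m]_x (s x)%:E = \int[m]_x ((EFin \o s) \_ (~` N)) x)%E.
    apply: ge0_ae_eq_integral => //.
    - by apply/(measurable_restrictT _ (measurableC mN)).1; exact: measurable_funTS.
    - by move=> x _; rewrite lee_fin.
    - by move=> x _; apply: erestrict_ge0 => y _ /=; rewrite lee_fin.
    - exists N; split=> // x /= /not_implyP[_]; apply: contra_notP => Nx.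
      by rewrite /patch ifT// inE.
  apply: ge0_le_integral => //.
  + by move=> x _; apply: erestrict_ge0 => y _ /=; rewrite lee_fin.
  + by apply/(measurable_restrictT _ (measurableC mN)).1; exact: measurable_funTS.
  + move=> x _; rewrite /patch; case: ifPn => // /set_mem Nx.
    by rewrite -fg1//; exact: sf.
- rewrite g2E !ge0_integralTE//; last by move=> x; exact: erestrict_ge0.
  apply: le_ereal_sup => _ [s /= sg <-]; exists s => // x /=.
  apply: le_trans (sg x) _; rewrite /patch; case: ifPn => // /set_mem Nx.
  by rewrite fg1.
Qed.

End modification.

Section tower_operator.
Variables (R : realType) (x0 : R) (T S0 S1 : R -> R).
Hypothesis hB : two_branched x0 T S0 S1.
Variable JF : tower_space R -> R.
Hypothesis hJF : is_jacobian x0 T JF.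
Variables (beta c C : R) (n : nat).
Hypotheses (hbeta : 0 < beta < 1) (hdist : distortion x0 T JF beta c).
Hypotheses (C0 : 0 < C) (hC : c / (1 - beta) <= C) (n0 : (1 <= n)%N).
Local Notation leb := (@lebesgue_measure R).
Local Notation h := (return_branch S0 S1).
Local Notation tower := (tower x0 T).
Local Notation hole := (hole x0 T n).
Local Notation cell := (cell x0 T).
Local Notation base_cell := (base_cell x0 T).
Local Notation regular := (regular x0 T S0 S1 JF).
Local Notation Pn := (conditional_op x0 T JF n).
Local Notation D := (tower `\` hole).
Implicit Types (X : set R) (phi psi : tower_space R -> R).

Definition sep_scale (x y : R) : R := beta_pow beta (sep_time_base x0 T x y).

Definition branch_weight (i : nat) (x : R) : R := `|JF (h i x, i)|^-1.

Let x01_of x : x0 < x < 1 -> 0 < x < 1. Proof. exact: (base_in_unit hB). Qed.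

Lemma regular01 X x : regular X -> X x -> x0 < x < 1.
Proof. by move=> rX /(regular_returning rX)/returning01. Qed.

Lemma base_cell_inj i j x : base_cell i x -> base_cell j x -> i = j.
Proof. by move=> [_ xi] [_]; rewrite xi => -[]. Qed.

Lemma regular_contracting X : regular X -> contracting_branches X h sep_scale beta.
Proof.
move=> rX; split.
- by move=> i x; exact: (regular_branch rX).
- by move=> x y; exact: beta_pow_ge0_le1.
- by move=> x y; rewrite /sep_scale sep_time_baseC.
- move=> i x y /(regular01 rX) xx /(regular01 rX) yy.
  by rewrite /sep_scale (sep_time_base_branch hB)// beta_pow_shift.
Qed.

Lemma tower_map_top i x : x0 < x < 1 -> tower_map x0 T (h i x, i) = (x, 0%N).
Proof.
move=> xx; rewrite /tower_map [(_, _).1]/=; have [_ ->] := base_cell_branch hB i xx.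
by rewrite ltnn (iter_T_branch hB)// x01_of.
Qed.

(** By the choice of [C], the constant [c] is at most [(1 - beta) * C]. *)
Lemma branch_weight_distorted X : regular X ->
  distorted_weight X sep_scale beta C branch_weight.
Proof.
move=> rX; split=> [i x Xx|i x y Xx Xy].
  by rewrite invr_gt0 normr_gt0 (regular_top rX).
have xx := regular01 rX Xx; have yy := regular01 rX Xy.
have sc : same_cell x0 T (h i y, i) (h i x, i).
  by exists i, i.+1; split; split=> //; split=> //; exact: (base_cell_branch hB).
have := hdist sc; rewrite !tower_map_top// /sep_time/= normf_div.
have Jx : 0 < `|JF (h i x, i)| by rewrite normr_gt0 (regular_top rX).
have Jy : 0 < `|JF (h i y, i)| by rewrite normr_gt0 (regular_top rX).
rewrite sep_time_baseC -/(sep_scale x y) ler_pdivrMr// => Jyx.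
rewrite /branch_weight [leRHS]mulrC ler_pdivlMr// mulrC ler_pdivrMr//.
apply: le_trans Jyx _; rewrite ler_wpM2r// ler_expR ler_wpM2r//.
  by case/andP: (beta_pow_ge0_le1 (sep_time_base x0 T x y) hbeta).
by move: hC; rewrite ler_pdivrMr ?subr_gt0 1?mulrC//; case/andP: hbeta.
Qed.

Lemma sum_over_finite (A : set (tower_space R)) (f : tower_space R -> R)
    (k : nat) (e : nat -> tower_space R) :
  (forall i, (i < k)%N -> A (e i)) -> injective e ->
  (forall z, A z -> f z != 0 -> exists2 i, (i < k)%N & z = e i) ->
  sum_over A f = \sum_(i < k) f (e i).
Proof.
move=> Ae einj supp.
have esumE (F : tower_space R -> R) : (forall z, 0 <= F z) ->
    (forall z, f z = 0 -> F z = 0) ->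
    (\esum_(z in A) (F z)%:E)%E = (\sum_(i < k) F (e i))%:E.
  move=> F0 Ff; rewrite (esumID (e @` `I_k)); last by move=> z _; rewrite lee_fin.
  rewrite [X in (_ + X)%E]esum1 ?adde0; last first.
    move=> z [Az nz]; rewrite Ff//; apply/eqP; apply: contra_notT nz => fz.
    by have [i ik ->] := supp z Az fz; exists i.
  rewrite (_ : A `&` _ = e @` `I_k); last first.
    by apply/setIidPr => _ [i /= ik <-]; exact: Ae.
  rewrite esum_image; last by move=> i j _ _; exact: einj.
  rewrite esum_fset//; last by move=> i _; rewrite lee_fin.
  by rewrite -fsbig_ord sumEFin.
have posE : (\esum_(z in A) ((EFin \o f)^\+ z))%E =
    (\sum_(i < k) Num.max (f (e i)) 0)%:E.
  rewrite -(esumE (fun z => Num.max (f z) 0)).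
  - by apply: eq_esum => z _; rewrite funeposE EFin_max.
  - by move=> z; rewrite le_max lexx orbT.
  - by move=> z ->; rewrite maxxx.
have negE : (\esum_(z in A) ((EFin \o f)^\- z))%E =
    (\sum_(i < k) Num.max (- f (e i)) 0)%:E.
  rewrite -(esumE (fun z => Num.max (- f z) 0)).
  - by apply: eq_esum => z _; rewrite funenegE -EFinN EFin_max.
  - by move=> z; rewrite le_max lexx orbT.
  - by move=> z ->; rewrite oppr0 maxxx.
rewrite /sum_over posE negE -EFinB /= -sumrB; apply: eq_bigr => i _.
by case: (leP 0 (f (e i))) => fe; [rewrite max_r|rewrite max_l]; lra.
Qed.

Lemma open_towerP z :
  D z <-> exists i, [/\ base_cell i z.1, (z.2 < i)%N & z.2 = 0%N \/ (i <= n)%N].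
Proof.
split=> [[[i zi li] nH]|[i [zi li lin]]].
  exists i; split=> //; case: (posnP z.2) => [|l0]; [by left|right].
  rewrite leqNgt; apply/negP => ni; apply: nH.
  by exists i, z.2; split=> //; apply/andP.
split; first by exists i.
move=> [j [l [nj /andP[l0 lj] [_ [zj zl]]]]].
rewrite (base_cell_inj zi zj) zl in lin li; case: lin => [l00|jn].
  by rewrite l00 in l0.
by move: (leq_ltn_trans jn nj); rewrite ltnn.
Qed.

Lemma conditional_op_up X phi x l i : regular X -> X x -> base_cell i x ->
  (l.+1 < i)%N -> (i <= n)%N -> Pn phi (x, l.+1) = phi (x, l).
Proof.
move=> rX Xx xi li ik; have li' : (l < i)%N by exact: ltnW.
have Dl : D (x, l) by apply/open_towerP; exists i; split=> //; right.
have Dl1 : D (x, l.+1) by apply/open_towerP; exists i; split=> //; right.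
have J1 : JF (x, l) = 1 by exact: (regular_below_top rX Xx xi).
have lr : (l < i.-1)%N by rewrite -ltnS prednK// (leq_ltn_trans _ li).
rewrite /conditional_op indicE mem_set// mul1r /perron_frobenius.
pose e (j : nat) := (x, (l + j)%N) : tower_space R.
rewrite (@sum_over_finite _ _ 1 e).
- by rewrite big_ord1 /e addn0 J1 normr1 divr1 indicE mem_set// mulr1.
- move=> [|//] _; rewrite /e addn0; split; first by case: Dl.
  by case: xi => _ /= rx; rewrite /tower_map/= rx lr.
- by move=> j j' [] /eqP; rewrite eqn_add2l => /eqP.
- move=> [y k] [[r /= [_ ry] kr]]; rewrite /tower_map/= ry.
  by case: ifPn => // _ [-> ->] _; exists 0%N; rewrite // /e addn0.
Qed.

(** The preimages of [(x, 0)] are the points [(h i x, i)] at the tops of the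
columns, and those with [i < n] are the ones outside the hole. *)
Lemma conditional_op_base X phi x : regular X -> X x ->
  Pn phi (x, 0%N) = \sum_(i < n) phi (h i x, i : nat) * branch_weight i x.
Proof.
move=> rX Xx; have xx := regular01 rX Xx.
have Dtop i : (i < n)%N -> D (h i x, i).
  move=> ik; apply/open_towerP; exists i.+1; split=> //; last by right.
  exact: (base_cell_branch hB).
have D0 : D (x, 0%N).
  have [_ [i _ xi]] := regular_returning rX Xx.
  apply/open_towerP; exists i; split=> //; last by left.
  by case: xi => _ /(return_timeP x0 T)[].
rewrite /conditional_op indicE mem_set// mul1r /perron_frobenius.
pose e (j : nat) := (h j x, j) : tower_space R.
rewrite (@sum_over_finite _ _ n e).
- by apply: eq_bigr => i _; rewrite indicE mem_set ?mulr1//; exact: Dtop.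
- by move=> i /Dtop[]; split=> //; rewrite tower_map_top.
- by move=> i j [].
- move=> [y k] [[r /= ry kr]]; case: (ry) => _ rt; rewrite /tower_map/= rt.
  case: ifPn => // kr1 [Tyx] fz.
  have [i ri yi] := cell_preimage hB ry Tyx (regular_nonsingular rX Xx).
  have ki : k = i.
    by apply/eqP; rewrite eqn_leq -ltnS -ri kr /=; move: kr1; rewrite ri -leqNgt.
  exists i; last by rewrite /e ki yi.
  rewrite ltnNge; apply/negP => ni; move/eqP: fz; apply.
  rewrite indicE memNset ?mulr0 ?mul0r// => /open_towerP[j /= [yj _]].
  rewrite ki => -[i0|jn]; first by move: n0; rewrite ltnNge -i0 ni.
  by move: jn; rewrite (base_cell_inj yj ry) ri leqNgt ltnS ni.
Qed.

Lemma measurable_hole : measurable hole.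
Proof.
have -> : hole = \bigcup_i \bigcup_l
    (if (n.+1 <= i)%N && (1 <= l)%N then cell l i else set0).
  apply/seteqP; split=> z.
    move=> [i [l [ni /andP[l0 li] zc]]]; exists i => //; exists l => //.
    by rewrite ni l0.
  move=> [i _ [l _]]; case: ifPn => // /andP[ni l0] zc; exists i, l; split=> //.
  by rewrite l0; case: zc.
apply: bigcupT_measurable => i; apply: bigcupT_measurable => l.
by case: ifP => // _; exact: (measurable_cell hB).
Qed.

Lemma measurable_open_tower : measurable D.
Proof. exact: measurableD (measurable_tower hB) measurable_hole. Qed.

(** The pointwise form, over [X], of being an eigenfunction in the cone.  The
eigenvalue [L] may be infinite, as an L1 norm may be. *)
Definition eigen_on X phi (L : \bar R) :=
  [/\ forall z, tower z -> X z.1 -> 0 <= phi z,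
      forall z w, X z.1 -> X w.1 -> Defs.comparable x0 T z w ->
        phi z <= phi w * expR (C * sep_scale z.1 w.1),
      forall z, hole z -> X z.1 -> phi z = 0 &
      forall z, tower z -> X z.1 -> ((Pn phi z)%:E = L * (phi z)%:E)%E].

Lemma hole_tower : hole `<=` tower.
Proof. by move=> z [i [l [_ _ /cell_tower]]]. Qed.

Lemma cone_n_eigen_on phi : cone_n x0 T beta C n phi ->
  cond_eigenfunction x0 T JF n phi ->
  exists N, (mu R).-negligible N /\
    forall X, (forall z, X z.1 -> ~ N z) -> eigen_on X phi (L1norm x0 T (Pn phi)).
Proof.
move=> [[_ ge0 [N1 [N10 phiC]]] _ phi0] eig.
exists (N1 `|` (~` [set z | tower z -> 0 <= phi z]) `|`
   (~` [set z | tower z -> hole z -> phi z = 0]) `|`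
   (~` [set z | tower z -> ((Pn phi z)%:E = L1norm x0 T (Pn phi) * (phi z)%:E)%E])).
split; first by apply: negligibleU => //; apply: negligibleU => //; apply: negligibleU.
move=> X XN; split.
- move=> z Tz /XN nN; apply: contrapT => h0; apply: nN.
  by left; left; right => /(_ Tz).
- move=> z w /XN nz /XN nw zw; apply: phiC => //.
    by move=> Nz; apply: nz; left; left; left.
  by move=> Nw; apply: nw; left; left; left.
- move=> z Hz /XN nN; apply: contrapT => h0; apply: nN.
  by left; right => /(_ (hole_tower Hz) Hz).
- move=> z Tz /XN nN; apply: contrapT => h0; apply: nN.
  by right => /(_ Tz).
Qed.

Lemma base_comparable X x y : regular X -> X x -> X y ->
  Defs.comparable x0 T (x, 0%N) (y, 0%N).
Proof.
move=> rX Xx Xy; right.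
have tb u : X u -> tower_base x0 T (u, 0%N).
  move=> /(regular_returning rX)[_ [i _ ui]]; split=> //; exists i => //.
  by case: ui => _ /(return_timeP x0 T)[].
by split; exact: tb.
Qed.

Lemma open_tower_tower z : D z -> tower z. Proof. by case. Qed.

Lemma ae_open_tower X phi psi : regular X ->
  measurable_fun tower phi -> measurable_fun tower psi ->
  (forall z, D z -> X z.1 -> phi z = psi z) ->
  (\int[mu R]_(z in D) (phi z)%:E = \int[mu R]_(z in D) (psi z)%:E)%E.
Proof.
move=> rX mphi mpsi e.
have sub f : measurable_fun tower f -> measurable_fun D (EFin \o f).
  move=> mf; apply/measurable_EFinP; apply: measurable_funS mf.
    exact: (measurable_tower hB).
  exact: open_tower_tower.
apply: (ae_eq_integral (EFin \o psi)) => //.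
- exact: measurable_open_tower.
- exact: sub.
- exact: sub.
- apply: negligibleS (regular_conull rX) => z /= /not_implyP[Dz pz].
  split; first exact: open_tower_tower.
  by move=> Xz; apply: pz; rewrite /= e.
Qed.

(** The equation forces [phi] to vanish if [L] is infinite.  If [L] is 0, it makes
[phi] vanish below the tops of the columns, then at the points [(h i x, i)] and,
by the cone condition, everywhere.  So [L] is a positive number, and [s] is
[- ln L]. *)
Lemma eigen_structure X phi L : regular X -> measurable_fun tower phi ->
  (\int[mu R]_(z in D) (phi z)%:E = 1)%E -> (0 <= L)%E -> eigen_on X phi L ->
  exists s : R,
  [/\ logcone X sep_scale C (fun x => phi (x, 0%N)),
      forall x, X x -> 0 < phi (x, 0%N),
      forall x, X x -> transfer n h (tilted branch_weight s)
        (fun y => phi (y, 0%N)) x = phi (x, 0%N) &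
      forall z, D z -> X z.1 -> phi z = expR (s * z.2%:R) * phi (z.1, 0%N)].
Proof.
move=> rX mphi int1 L0 [phi0 phiC _ eig].
have [p Xp] := regular_nonempty hB rX.
have hX i x : X x -> X (h i x) := @regular_branch _ _ _ _ _ _ _ rX i x.
have notall0 : ~ (forall z, D z -> X z.1 -> phi z = 0).
  have m0 : measurable_fun tower (fun=> 0 : R) by exact: measurable_cst.
  move=> all0; have := ae_open_tower rX mphi m0 all0.
  by rewrite int1 integral0 => /eqP; rewrite onee_eq0.
(* The base points of [X] do return, so they are in the tower. *)
have towerX x : X x -> tower (x, 0%N).
  by move=> Xx; case: (base_comparable rX Xx Xx) => [[l [i [/cell_tower]]]|[[]]].
have fC : logcone X sep_scale C (fun x => phi (x, 0%N)).
  split=> [x Xx|x y Xx Xy]; first by apply: phi0 => //; exact: towerX.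
  exact: (phiC (x, 0%N) (y, 0%N) Xx Xy (base_comparable rX Xx Xy)).
have up x l i : X x -> base_cell i x -> (l.+1 < i)%N -> (i <= n)%N ->
    ((phi (x, l))%:E = L * (phi (x, l.+1))%:E)%E.
  move=> Xx xi li ik; rewrite -(conditional_op_up phi rX Xx xi li ik).
  by apply: eig => //; exists i.
have base x : X x -> ((\sum_(i < n) phi (h i x, i : nat) * branch_weight i x)%:E =
    L * (phi (x, 0%N))%:E)%E.
  move=> Xx; rewrite -(conditional_op_base phi rX Xx).
  by apply: eig => //; exact: towerX.
have w0 i x : X x -> 0 < branch_weight i x.
  by move=> Xx; case: (branch_weight_distorted rX) => w0 _; exact: w0.
have Dtop i x : X x -> (i < n)%N -> tower (h i x, i).
  move=> Xx ik; exists i.+1 => //.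
  exact: (base_cell_branch hB _ (regular01 rX Xx)).
case: L L0 eig up base => [r|_ eig _ _|//].
  rewrite lee_fin le_eqVlt => /predU1P[<-|r0] eig up base.
    exfalso; apply: notall0.
    (* Eigenvalue 0: the values below the tops vanish, then those at the tops. *)
    have up0 x l i : X x -> base_cell i x -> (l.+1 < i)%N -> (i <= n)%N ->
        phi (x, l) = 0.
      by move=> Xx xi li ik; have := up x l i Xx xi li ik; rewrite mul0e => -[].
    have top0 x i : X x -> (i < n)%N -> phi (h i x, i) = 0.
      move=> Xx ik; have := base x Xx; rewrite mul0e => -[].
      move=> /eqP; rewrite psumr_eq0; last first.
        move=> j _; rewrite mulr_ge0 ?(ltW (w0 _ _ _))//.
        by apply: phi0; [exact: Dtop|exact: hX].
      move=> /allP/(_ (Ordinal ik)); rewrite mem_index_enum => /(_ isT) /=.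
      by rewrite mulf_eq0 [X in _ || X]gt_eqF ?w0// orbF => /eqP.
    have f0 x : X x -> phi (x, 0%N) = 0.
      move=> Xx; apply/eqP; rewrite eq_le (fC.1 x Xx) andbT.
      have := fC.2 x (h 0%N p) Xx (hX _ _ Xp).
      by rewrite top0// mul0r.
    move=> [x l] /open_towerP[i /= [xi li ln]] Xx.
    case: l li ln => [|l] li ln; first exact: f0.
    case: ln => // ik.
    move: li; rewrite leq_eqVlt => /predU1P[il|li]; last exact: (up0 _ _ _ Xx xi li ik).
    have lk : (l.+1 < n)%N by rewrite il.
    apply/eqP; rewrite eq_le; apply/andP; split; last first.
      by apply: phi0 => //; exists i; rewrite //= -il.
    have xc : cell l.+1 i (x, l.+1) by split; rewrite ?il.
    have yc : cell l.+1 i (h l.+1 p, l.+1).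
      split; first by rewrite il.
      by split=> //; rewrite -il; exact: (base_cell_branch hB _ (regular01 rX Xp)).
    have := phiC (x, l.+1) (h l.+1 p, l.+1) Xx (hX _ _ Xp).
    by rewrite top0// mul0r; apply; left; exists l.+1, i.
  pose s := - ln r; have er : expR s = r^-1 by rewrite /s expRN lnK.
  have colE z : D z -> X z.1 -> phi z = expR (s * z.2%:R) * phi (z.1, 0%N).
    case: z => x l /open_towerP[i /= [xi li ln]] Xx.
    elim: l li ln => [|l IH] li ln; first by rewrite mulr0 expR0 mul1r.
    case: ln => // ik; have li' := ltnW li.
    rewrite -natr1 mulrDr mulr1 expRD mulrAC -IH//; last by right.
    rewrite er; have := up x l i Xx xi li ik; rewrite -EFinM => -[->].
    by rewrite mulrC mulKf// gt_eqF.
  exists s; split=> //.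
  - move=> x Xx; rewrite lt_neqAle (fC.1 x Xx) andbT eq_sym; apply/eqP => fx0.
    apply: notall0 => z Dz Xz; rewrite colE//.
    suff -> : phi (z.1, 0%N) = 0 by rewrite mulr0.
    apply/eqP; rewrite eq_le (fC.1 _ Xz) andbT.
    by have := fC.2 z.1 x Xz Xx; rewrite fx0 mul0r.
  - move=> x Xx; have := base x Xx; rewrite -EFinM => -[baseE].
    apply: (mulfI (lt0r_neq0 r0)); rewrite -baseE /transfer mulr_sumr.
    apply: eq_bigr => i _; rewrite (colE (h i x, i : nat)) /=; first last.
    + exact: hX.
    + apply/open_towerP; exists i.+1; split=> //; last by right.
      exact: (base_cell_branch hB _ (regular01 rX Xx)).
    + by rewrite /tilted -natr1 mulrDr mulr1 expRD er; field; rewrite gt_eqF.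
(* Case of an infinite eigenvalue: an infinite product unless [phi] is 0. *)
exfalso; apply: notall0 => z Dz Xz; apply/eqP; apply: contraT => phiz.
have Tz := open_tower_tower Dz.
have z0 : (0 < (phi z)%:E)%E by rewrite lte_fin lt_neqAle eq_sym phiz phi0.
by have := eig z Tz Xz; rewrite gt0_mulye.
Qed.

(** By [eigen_structure] both functions come from fixed functions on the base of
transfer operators, which are proportional by [critical_tilt_unique]; equal
integrals make the factor 1. *)
Lemma eigenfunction_unique phi psi :
  cone_n x0 T beta C n phi -> cond_eigenfunction x0 T JF n phi ->
  cone_n x0 T beta C n psi -> cond_eigenfunction x0 T JF n psi ->
  ae_tower x0 T [set z | psi z = phi z].
Proof.
move=> cphi ephi cpsi epsi.
have [N1 [N10 on1]] := cone_n_eigen_on cphi ephi.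
have [N2 [N20 on2]] := cone_n_eigen_on cpsi epsi.
have [X [rX XN]] := regular_exists hB hJF (negligibleU N10 N20).
have e1 : eigen_on X phi (L1norm x0 T (Pn phi)).
  by apply: on1 => z /XN nN Nz; apply: nN; left.
have e2 : eigen_on X psi (L1norm x0 T (Pn psi)).
  by apply: on2 => z /XN nN Nz; apply: nN; right.
have L0 u : (0 <= L1norm x0 T u)%E.
  by apply: integral_ge0 => z _; rewrite lee_fin.
case: (cphi) => [[i1 _ _] int1 _]; case: (cpsi) => [[i2 _ _] int2 _].
have m1 : measurable_fun tower phi by apply/measurable_EFinP; exact: measurable_int i1.
have m2 : measurable_fun tower psi by apply/measurable_EFinP; exact: measurable_int i2.
have [s [fC f0 ff fcol]] := eigen_structure rX m1 int1 (L0 _) e1.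
have [t [gC g0 gf gcol]] := eigen_structure rX m2 int2 (L0 _) e2.
have [p Xp] := regular_nonempty hB rX.
have [st fg] := critical_tilt_unique (regular_contracting rX) n0 hbeta C0 Xp
  (branch_weight_distorted rX) fC gC (f0 p Xp) (g0 p Xp) ff gf.
pose K := psi (p, 0%N) / phi (p, 0%N).
have psiE z : D z -> X z.1 -> psi z = K * phi z.
  move=> Dz Xz; rewrite fcol// gcol// -st /K.
  have := fg _ Xz; have := lt0r_neq0 (f0 p Xp) => fp e.
  apply: (mulIf fp); rewrite -[LHS]mulrA -e; field.
  exact: fp.
have K1 : K = 1.
  have m3 : measurable_fun tower (fun z => K * phi z).
    by apply: measurable_funM => //; exact: measurable_cst.
  have := ae_open_tower rX m2 m3 psiE.
  under [RHS]eq_integral do rewrite EFinM.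
  rewrite integralZl ?int1 ?int2 ?mule1//; last first.
  - apply: integrableS i1; [exact: (measurable_tower hB)|
      exact: measurable_open_tower|exact: open_tower_tower].
  - exact: measurable_open_tower.
  by move=> -[].
apply: negligibleS (regular_conull rX) => z /= /not_implyP[Tz pz]; split=> // Xz.
apply: pz; have [Dz|nD] := pselect (D z); first by rewrite psiE// K1 mul1r.
have Hz : hole z by apply: contrapT => nH; apply: nD.
case: e1 => _ _ h1 _; case: e2 => _ _ h2 _; by rewrite h1// h2.
Qed.

Lemma measurable_branch_on X i : regular X -> measurable_fun X (h i).
Proof.
move=> rX; apply: measurable_funS (measurable_branch hB i) => //.
by move=> x /(regular01 rX) /x01_of; rewrite /= in_itv.
Qed.

Lemma measurable_branch_weight X i : regular X ->
  measurable_fun X (branch_weight i).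
Proof.
move=> rX.
have mJi : measurable_fun X (fun x => JF (h i x, i)).
  apply: (measurable_comp (F := branch_image x0 T S0 S1 i) (f := fun y => JF (y, i))).
  - exact: (measurable_branch_image hB).
  - by move=> _ [x /(regular01 rX) xx <-]; exact: (branch_image_branch hB).
  - exact: (measurable_top_jacobian hB hJF).
  - exact: measurable_branch_on.
(* Off 0, the inverse of [t] is [expR (- ln t)], and these are measurable. *)
apply: (eq_measurable_fun (fun x => expR (- ln `|JF (h i x, i)|))).
  move=> x /set_mem Xx; rewrite /branch_weight expRN lnK// posrE normr_gt0.
  exact: (regular_top rX).
apply: measurableT_comp; first exact: measurable_expR.
apply: measurableT_comp => //.
apply: measurableT_comp; first exact: measurable_ln.
by apply: measurableT_comp mJi => //; exact: normr_measurable.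
Qed.

Lemma measurable_iter_transfer X s k : regular X ->
  measurable_fun X (iter k (transfer n h (tilted branch_weight s)) (fun=> 1)).
Proof.
move=> rX; elim: k => [|k IH] /=; first exact: measurable_cst.
apply: measurable_sum => i; apply: measurable_funM.
  apply: measurable_funM; first exact: measurable_cst.
  exact: measurable_branch_weight.
apply: (measurable_comp (F := X)) => //.
- exact: (regular_measurable rX).
- by move=> _ [x Xx <-]; exact: (regular_branch rX).
- exact: measurable_branch_on.
Qed.

Lemma open_tower_level z : D z -> x0 <= z.1 <= 1 /\ (z.2 <= n)%N.
Proof.
move=> /open_towerP[i [[z1 _] zi [->//|ni]]]; split=> //.
exact: leq_trans (ltnW zi) ni.
Qed.

Lemma open_tower_finite : (mu R D < +oo)%E.
Proof.
have sub : D `<=` `[0, 1] `*` `I_n.+1.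
  move=> z /open_tower_level[/andP[z0 z1] zn]; split=> //=.
  rewrite in_itv/= z1 andbT; case: hB => /andP[p0 _] _ _ _ _.
  exact: le_trans (ltW p0) z0.
pose J : set (measurableTypeR R) := `[0, 1]%classic.
have mI : measurable (`I_n.+1 : set nat) by [].
have mJ : measurable J by exact: measurable_itv.
apply: (@le_lt_trans _ _ (mu R (J `*` `I_n.+1))).
  apply: le_measure => //; rewrite inE; first exact: measurable_open_tower.
  exact: measurableX.
have -> : mu R (J `*` `I_n.+1) = (leb J * @counting nat R `I_n.+1)%E.
  exact: (product_measure1E leb (@counting nat R) mJ mI).
rewrite lebesgue_measure_itv/= lte_fin ltr01 oppr0 adde0 mul1e.
by rewrite /counting asboolT ?ltry//; exact: finite_II.
Qed.

(** Spread the fixed function of [critical_tilt] along the columns of height at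
most [n] with the factor [expR s] per level, and normalize.  On the complement
of the hole there are finitely many levels, so the result inherits positive
bounds from the fixed function. *)
Lemma eigenfunction_exists : exists phi,
  [/\ cone_n x0 T beta C n phi, cond_eigenfunction x0 T JF n phi &
   exists a b : R, [/\ 0 < a, 0 < b &
     ae_tower x0 T [set z | ~ hole z -> a <= phi z <= b]]].
Proof.
have [X [rX _]] := regular_exists hB hJF (negligible_set0 (mu R)).
have [p Xp] := regular_nonempty hB rX.
have [s [a [f [fC fp ff fcvg]]]] := critical_tilt (regular_contracting rX) n0
  hbeta C0 Xp (branch_weight_distorted rX).
have mf : measurable_fun X f.
  apply: (measurable_fun_cvg
    (h := fun k x => a k * iter k (transfer n h (tilted branch_weight s)) (fun=> 1) x)).
    move=> k; apply: measurable_funM; first exact: measurable_cst.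
    exact: measurable_iter_transfer.
  exact: fcvg.
pose G := D `&` [set z | X z.1].
pose g (z : tower_space R) : R := expR (s * z.2%:R) * f z.1.
have mX := regular_measurable rX.
have mXc : measurable [set z : tower_space R | X z.1].
  rewrite (_ : [set z | _] = X `*` setT); first exact: measurableX.
  by apply/seteqP; split=> z //= [].
have mG : measurable G by apply: measurableI => //; exact: measurable_open_tower.
have mg : measurable_fun G g.
  apply: measurable_funM.
    apply: (measurableT_comp (f := fun l : nat => expR (s * l%:R))) => //.
    by apply: measurable_funTS; exact: measurable_snd.
  apply: (measurable_comp (F := X)) => //.
  - by move=> _ [z [_ Xz] <-].
  - by apply: measurable_funTS; exact: measurable_fst.
pose phi0 (z : tower_space R) : R := \1_G z * (g \_ G) z.
have phi0G z : G z -> phi0 z = g z.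
  by move=> Gz; rewrite /phi0 /patch indicE mem_set// mul1r.
have phi0N z : ~ G z -> phi0 z = 0.
  by move=> Gz; rewrite /phi0 indicE memNset// mul0r.
have mphi0 : measurable_fun setT phi0.
  apply: measurable_funM; first exact: measurable_indic.
  exact: ((measurable_restrictT g mG).1 mg).
pose M := `|s| * n%:R + C.
have gbound z : G z -> expR (- M) <= g z <= expR M.
  move=> [Dz Xz]; have [_ zn] := open_tower_level Dz.
  have fz : expR (- C) <= f z.1 <= expR C.
    have := logcone_harnack (regular_contracting rX) (ltW C0) fC Xz Xp.
    have := logcone_harnack (regular_contracting rX) (ltW C0) fC Xp Xz.
    by rewrite fp mul1r expRN => + ->; rewrite andbT -ler_pdivrMr ?expR_gt0// mul1r.
  have sz : - (`|s| * n%:R) <= s * z.2%:R <= `|s| * n%:R.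
    rewrite -ler_norml normrM ler_wpM2l// ger0_norm// ler_nat//.
  case/andP: fz => f1 f2; case/andP: sz => s1 s2.
  rewrite /g /M opprD !expRD; apply/andP; split.
    by rewrite ler_pM ?expR_ge0 ?ler_expR.
  rewrite ler_pM ?expR_ge0 ?ler_expR//; exact: le_trans (expR_ge0 _) f1.
have phi00 z : 0 <= phi0 z.
  have [Gz|nG] := pselect (G z); last by rewrite phi0N.
  by rewrite phi0G//; case/andP: (gbound z Gz) => + _; apply: le_trans; exact: expR_ge0.
have phi0M z : phi0 z <= expR M.
  have [Gz|nG] := pselect (G z); last by rewrite phi0N// expR_ge0.
  by rewrite phi0G//; case/andP: (gbound z Gz).
pose I := (\int[mu R]_(z in D) (phi0 z)%:E)%E.
have mD := measurable_open_tower.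
have mphi0D : measurable_fun D (EFin \o phi0).
  by apply/measurable_EFinP; exact: measurable_funTS.
have I_lty : (I < +oo)%E.
  apply: (@le_lt_trans _ _ (\int[mu R]_(z in D) cst (expR M)%:E z)%E).
    apply: ge0_le_integral => //.
    - by move=> z _; rewrite lee_fin.
    - by move=> z _; rewrite lee_fin.
  by rewrite integral_cst// lte_mul_pinfty ?lee_fin ?expR_ge0//; exact: open_tower_finite.
have I_gt0 : (0 < I)%E.
  have muG : (0 < mu R G)%E.
    rewrite lt_neqAle measure_ge0 andbT eq_sym; apply/eqP => G0.
    have nG : (mu R).-negligible G by exists G; split.
    have [B [mB B0 TB]] := negligible_slices (negligibleU (regular_conull rX) nG).
    have := base_cell1_measure_gt0 hB; rewrite -B0 ltNge => /negP; apply.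
    rewrite le_measure ?inE//; first exact: (measurable_base_cell hB).
    move=> x x1; apply: (TB (x, 0%N)).
    have Dx : D (x, 0%N) by apply/open_towerP; exists 1%N; split=> //; left.
    by have [Xx|nX] := pselect (X x); [right|left; split=> //; case: Dx].
  apply: (@lt_le_trans _ _ (\int[mu R]_(z in G) cst (expR (- M))%:E z)%E).
    by rewrite integral_cst// mule_gt0// lte_fin expR_gt0.
  apply: (@le_trans _ _ (\int[mu R]_(z in G) (phi0 z)%:E)%E).
    apply: ge0_le_integral => //.
    - by move=> z _; rewrite lee_fin expR_ge0.
    - by apply/measurable_EFinP; exact: measurable_funTS.
    - by move=> z Gz; rewrite lee_fin phi0G//; case/andP: (gbound z Gz).
  apply: ge0_subset_integral => //; last exact: subIsetl.
  by move=> z _; rewrite lee_fin.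
have I_fin : I \is a fin_num by rewrite ge0_fin_numE ?ltW.
pose K := (fine I)^-1.
have fI0 : 0 < fine I by rewrite fine_gt0// I_gt0.
have K0 : 0 < K by rewrite invr_gt0.
pose phi z := K * phi0 z.
have mphi : measurable_fun setT phi by apply: measurable_funM => //; exact: measurable_cst.
have phige0 z : 0 <= phi z by rewrite mulr_ge0// ltW.
have phiG z : D z -> X z.1 -> phi z = K * (expR (s * z.2%:R) * f z.1).
  by move=> Dz Xz; rewrite /phi phi0G.
have phiN z : ~ D z -> phi z = 0.
  by move=> nD; rewrite /phi phi0N ?mulr0// => -[].
have int1 : (\int[mu R]_(z in D) (phi z)%:E = 1)%E.
  under eq_integral do rewrite EFinM.
  rewrite ge0_integralZl//; last 2 first.
  - by move=> z _; rewrite lee_fin.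
  - by rewrite lee_fin ltW.
  by rewrite -/I -(fineK I_fin) -EFinM mulVf// gt_eqF.
have intT : (\int[mu R]_(z in tower) (phi z)%:E = 1)%E.
  rewrite -int1 [LHS]integral_mkcond [RHS]integral_mkcond; apply: eq_integral => z _.
  rewrite /patch; case: ifPn => [/set_mem Tz|/negP nT].
    by case: ifPn => // /negP nD; rewrite phiN// => Dz; apply: nD; exact: mem_set.
  case: ifPn => // /set_mem Dz; case: nT; apply: mem_set; exact: open_tower_tower.
have mT := measurable_tower hB.
pose lam := expR (- s).
have eig z : tower z -> X z.1 -> Pn phi z = lam * phi z.
  move=> Tz Xz; have [Dz|nD] := pselect (D z); last first.
    by rewrite phiN// mulr0 /conditional_op indicE memNset// mul0r.
  move: z Tz Dz Xz => [x [|l]] Tz Dz Xx.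
    rewrite (conditional_op_base phi rX Xx) phiG//= mulr0 expR0 mul1r.
    rewrite -(ff x Xx) /transfer !mulr_sumr; apply: eq_bigr => i _.
    rewrite phiG /=; first last.
    - exact: (regular_branch rX).
    - apply/open_towerP; exists i.+1; split=> //; last by right.
      exact: (base_cell_branch hB _ (regular01 rX Xx)).
    have -> : expR (s * i%:R) = lam * expR (s * i.+1%:R).
      by rewrite /lam -expRD -natr1; congr expR; ring.
    rewrite /tilted; ring.
  move/open_towerP: (Dz) => [i [/= xi li [//|ni]]].
  rewrite (conditional_op_up phi rX Xx xi li ni) !phiG//=; last first.
    by apply/open_towerP; exists i; split=> //; [exact: ltnW|right].
  have -> : expR (s * l%:R) = lam * expR (s * l.+1%:R).
    by rewrite /lam -expRD -natr1; congr expR; ring.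
  ring.
have Lam : L1norm x0 T (Pn phi) = lam%:E.
  rewrite /L1norm (ge0_integral_ae_modification (g := fun z => (lam * phi z)%:E))//.
  - under eq_integral do rewrite EFinM.
    rewrite ge0_integralZl//; last 3 first.
    + by apply/measurable_EFinP; exact: measurable_funTS.
    + by move=> z _; rewrite lee_fin.
    + by rewrite lee_fin expR_ge0.
    by rewrite intT mule1.
  - apply/measurable_EFinP; apply: measurable_funM; first exact: measurable_cst.
    exact: measurable_funTS.
  - by move=> z _; rewrite lee_fin mulr_ge0// expR_ge0.
  - apply: negligibleS (regular_conull rX) => z /= /not_implyP[Tz pz]; split=> // Xz.
    by apply: pz; rewrite eig// ger0_norm// mulr_ge0// expR_ge0.
have L1phi : in_L1 x0 T phi.
  apply/integrableP; split; first by apply/measurable_EFinP; exact: measurable_funTS.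
  under eq_integral do rewrite /= ger0_norm//.
  by rewrite intT ltry.
have tower_sub z w : Defs.comparable x0 T z w -> tower z /\ tower w.
  by move=> [[l [i [/cell_tower Tz /cell_tower Tw]]]|[[Tz _] [Tw _]]].
have compD z w : Defs.comparable x0 T z w -> z.2 = w.2 /\ (D z -> D w).
  move=> [[l [i [[li [zi zl]] [_ [wi wl]]]]]|[[Tz z0] [[i wi iw] w0]]].
    rewrite zl wl; split=> // /open_towerP[j [zj _ hj]].
    apply/open_towerP; exists i; rewrite wl; split=> //.
    by move: hj; rewrite (base_cell_inj zi zj) zl.
  rewrite z0 w0; split=> // _; apply/open_towerP.
  by exists i; split=> //; left.
exists phi; split.
- split.
  + split; [exact: L1phi|by apply: aeW => z _; exact: phige0|].
    exists [set z | tower z /\ ~ X z.1]; split; first exact: (regular_conull rX).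
    move=> z w nz nw zw; have [Tz Tw] := tower_sub z w zw.
    have Xz : X z.1 by apply: contrapT => nX; apply: nz.
    have Xw : X w.1 by apply: contrapT => nX; apply: nw.
    have [zw2 Dzw] := compD z w zw.
    have [Dz|nD] := pselect (D z); last by rewrite phiN// mulr_ge0 ?expR_ge0.
    rewrite !phiG//; last exact: Dzw.
    rewrite zw2 -!mulrA ler_wpM2l ?(ltW K0)// ler_wpM2l ?expR_ge0//.
    by case: fC => _; apply.
  + exact: int1.
  + by apply: aeW => z Tz Hz; rewrite phiN// => -[].
- apply: negligibleS (regular_conull rX) => z /= /not_implyP[Tz pz]; split=> // Xz.
  by apply: pz; rewrite Lam -EFinM eig.
- exists (K * expR (- M)), (K * expR M); split; [by rewrite mulr_gt0 ?expR_gt0..|].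
  apply: negligibleS (regular_conull rX) => z /= /not_implyP[Tz pz]; split=> // Xz.
  apply: pz => nH; rewrite !ler_pM2l// phi0G; last by split.
  by apply: gbound; split.
Qed.

End tower_operator.

Theorem corollary4p3 (R : realType) (alpha x0 : R) (T : R -> R)
    (hT : pomeau_manneville alpha x0 T)
    (JF : tower_space R -> R) (beta c C : R)
    (hF : nonsingular x0 T)
    (hJF : is_jacobian x0 T JF)
    (hbeta : 0 < beta < 1)
    (hdist : distortion x0 T JF beta c)
    (hC0 : 0 < C)
    (hC : c / (1 - beta) <= C) :
  forall n : nat, (1 <= n)%N ->
  exists phi : tower_space R -> R,
    [/\ cone_n x0 T beta C n phi,
        cond_eigenfunction x0 T JF n phi,
        (forall psi : tower_space R -> R,
           cone_n x0 T beta C n psi -> cond_eigenfunction x0 T JF n psi ->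
           ae_tower x0 T [set z | psi z = phi z])
      & exists a b : R, [/\ 0 < a, 0 < b
          & ae_tower x0 T
              [set z | ~ hole x0 T n z -> a <= phi z <= b]]].
Proof.
move=> n n0; have [S0 [S1 hB]] := pomeau_manneville_branches hT.
have [phi [cphi ephi bphi]] :=
  eigenfunction_exists hB hJF hbeta hdist hC0 hC n0.
exists phi; split=> // psi cpsi epsi.
exact: (eigenfunction_unique hB hJF hbeta hdist hC0 hC n0).
Qed.
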